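(* Let $\delta\ge 0$ be an integer and let $\mathcal{L}=\mathcal{O}(-d_1,-d_2)$ be an invertible sheaf on the Hirzebruch surface $S_\delta$, where $d_2\ge 1$ and: $d_1\ge 1$ if $\delta=0$; $d_1\ge 0$ if $\delta=1$; $d_1\ge 2$ if $\delta\ge 2$. Let $\mathcal{F}=[s]\in \mathrm{Fol}(\mathcal{L},S_\delta)=\mathbb{P}H^0(S_\delta,\Theta_{S_\delta}\otimes\mathcal{L}^* )$ be a foliation with isolated singularities and let $Z$ be its singular scheme. (i) If $s'\in H^0(S_\delta,\Theta_{S_\delta}\otimes \mathcal{L}^* )$ is any other section with the same singular scheme $Z$, then there exists an invertible global endomorphism $\Phi$ of the tangent bundle $TS_\delta$ such that $s'=\Phi(s)$. (ii) Moreover, if the affine $1$-form $\Omega=A_0\,dX_0+A_1\,dX_1+B_0\,dY_0+B_1\,dY_1$ represents $s$, then any section $s'=\Phi(s)$, with $\Phi$ an invertible global endomorphism of $TS_\delta$, is represented by an affine $1$-form $\Omega'$ of the form $$\Omega'=\begin{cases} a(A_0\,dX_0+A_1\,dX_1)+d(B_0\,dY_0+B_1\,dY_1), & a,d\in\mathbb{C}^*,\ \text{if }\delta=0,\\ a\,\Omega, & a\in\mathbb{C}^*,\ \text{if }\delta=1,\\ a\,\Omega-Y_1\,C(X_0,X_1)\,B_0\,(X_1\,dX_0-X_0\,dX_1), & a\in\mathbb{C}^*,\ C\in H^0(\mathbb{P}^1,\mathcal{O}_{\mathbb{P}^1}(\delta-2)),\ \text{if }\delta\ge 2.\end{cases}$$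 (iii) In particular, if $\delta=1$, then $\mathcal{F}=[s]$ is uniquely determined by $Z$, in the sense that $\mathcal{F}$ is the unique foliation in $\mathrm{Fol}(\mathcal{L},S_1)$ with singular scheme $Z$.
   Context: Everything is over $\mathbb{C}$. For an integer $\delta\ge 0$, the Hirzebruch surface $S_\delta=\mathbb{P}(\mathcal{O}_{\mathbb{P}^1}\oplus\mathcal{O}_{\mathbb{P}^1}(-\delta))$ is the quotient $\pi:(\mathbb{C}^2\setminus\{0\})\times(\mathbb{C}^2\setminus\{0\})\to S_\delta$ by the action of $(\mathbb{C}^* )^2$ given by $(\lambda,\mu)\cdot(X_0,X_1,Y_0,Y_1)=(\lambda X_0,\lambda X_1,\mu Y_0,\lambda^{-\delta}\mu Y_1)$. Its divisor class group is free on $F,M$ with $F^2=0$, $M^2=\delta$, $F\cdot M=1$ ($F$ is the class of $\{X_0=0\}$, $M$ the class of $\{Y_0=0\}$); $\mathcal{O}=\mathcal{O}_{S_\delta}$ and $\mathcal{O}(d_1,d_2)$ is the invertible sheaf of class $d_1F+d_2M$. Its global sections are the bi-homogeneous polynomials of bi-degree $(d_1,d_2)$: those all of whose monomials $X_0^\alpha X_1^\beta Y_0^\gamma Y_1^\mu$ satisfy $\alpha+\beta-\delta\mu=d_1$ and $\gamma+\mu=d_2$. $\Theta_{S_\delta}$ and $\Omega^1_{S_\delta}$ are the tangent and cotangent sheaves. A foliation with tangent sheaf $\mathcal{L}$ is a class $[s]$, up to nonzero scalars, of a nonzero section $s\in H^0(S_\delta,\Theta_{S_\delta}\otimes\mathcal{L}^*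 )=H^0(S_\delta,\mathrm{Hom}_{\mathcal{O}}(\mathcal{L},\Theta_{S_\delta}))$; the space of these is $\mathrm{Fol}(\mathcal{L},S_\delta)$. The singular scheme $Z=Z_s$ of $s$ (and of $[s]$) is the closed subscheme whose ideal sheaf $I_Z$ is locally generated by the two coefficients of a local vector field defining $s$. The foliation $[s]$ has isolated singularities if $\dim Z_s=0$. A global endomorphism $\Phi\in H^0(S_\delta,\mathrm{Hom}_{\mathcal{O}}(\Theta_{S_\delta},\Theta_{S_\delta}))$ acts on sections by composition: $\Phi(s)=\Phi\circ s$. Affine $1$-forms: with $\mathcal{L}=\mathcal{O}(-d_1,-d_2)$, contraction with $2$-forms gives $\Theta_{S_\delta}\otimes\mathcal{L}^*\cong\Omega^1_{S_\delta}(d_1+2-\delta,d_2+2)$, sending a section $s$ to its annihilator, and sections of the latter sheaf are identified (by pullback by $\pi$) with affine $1$-forms $\Omega=A_0dX_0+A_1dX_1+B_0dY_0+B_1dY_1$ with $A_0,A_1\in H^0(\mathcal{O}(d_1-\delta+1,d_2+2))$, $B_0\in H^0(\mathcal{O}(d_1-\delta+2,d_2+1))$, $B_1\in H^0(\mathcal{O}(d_1+2,d_2+1))$ satisfying $X_0A_0+X_1A_1-\delta Y_1B_1=0$ and $Y_0B_0+Y_1B_1=0$. One says that $\Omega$ represents $s$; this determines $\Omega$ up to a nonzero scalar. The space $H^0(\mathbb{P}^1,\mathcal{O}_{\mathbb{P}^1}(\delta-2))$ is the space of homogeneous polynomials of degree $\delta-2$ in $X_0,X_1$ (including $0$). *)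

(* Defs.v *)
From HB Require Import structures.
From mathcomp Require Import all_boot all_order all_algebra.
From mathcomp Require Import complex.
From mathcomp Require Import mpoly.
From mathcomp Require Import reals.

Set Implicit Arguments.
Unset Strict Implicit.
Unset Printing Implicit Defensive.

Import Order.TTheory GRing.Theory Num.Theory.
Local Open Scope ring_scope.

(* The Hirzebruch surface S_delta, for delta : nat, is handled through its
   standard cover by four affine planes.  The chart (i, j) is
     U_(i,j) = {X_i != 0, Y_j != 0}   (false and true stand for 0 and 1)
   with coordinates
     x = X_(1-i) / X_i,
     y = Y_1 X_i^delta / Y_0 if j = 0,   y = Y_0 / (X_i^delta Y_1) if j = 1,
   so that (x, y) in U_(i,j) = A^2 is the image under pi of the point with
   X_i = Y_j = 1, X_(1-i) = x, Y_(1-j) = y (see [chart_point]).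

   Coordinate changes:
     (i,j) -> (1-i,j), on {x != 0} :  (x, y) |-> (x^-1, x^e y),
                                      e = delta if j = 0, - delta if j = 1;
     (i,j) -> (i,1-j), on {y != 0} :  (x, y) |-> (x, y^-1).
   The overlap of U_(i,j) and U_(1-i,1-j) is contained in all the charts, so
   compatibility there follows from these two kinds of coordinate changes.

   A global section of a locally free sheaf is a family, indexed by the charts,
   of vectors of polynomials in C[x, y] that agree on the overlaps.  Since the
   ground field is infinite, agreement is stated at the points of overlaps. *)
Definition chart : Type := (bool * bool)%type.

Section Hirzebruch.

Variable K : numClosedFieldType.
Variable delta : nat.

Definition coord_x : {mpoly K[2]} := 'X_(@Ordinal 2 0 isT).
Definition coord_y : {mpoly K[2]} := 'X_(@Ordinal 2 1 isT).

Definition eval2 (x y : K) (p : {mpoly K[2]}) : K := p.@[tnth [tuple x; y]].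

Definition mx2 (a b c d : K) : 'M[K]_2 :=
  \matrix_(r, k) (if r == ord0 then (if k == ord0 then a else b)
                  else (if k == ord0 then c else d)).

Definition twist (j : bool) : int := if j then - delta%:Z else delta%:Z.

(* Jacobian matrices at (x, y) of the two kinds of coordinate changes. *)
Definition jacX (j : bool) (x y : K) : 'M[K]_2 :=
  mx2 (- (x ^ (- 2%:Z))) 0
      ((twist j)%:~R * x ^ (twist j - 1) * y) (x ^ twist j).

Definition jacY (y : K) : 'M[K]_2 :=
  mx2 1 0
      0 (- (y ^ (- 2%:Z))).

(* The sheaf O(d1, d2) is generated on U_(i,j) by X_i^d1 W^d2, where W = Y_0 if
   j = 0 and W = X_i^delta Y_1 if j = 1.  The two functions below are the
   ratios of the generator on U_(1-i,j), resp. U_(i,1-j), to that on U_(i,j). *)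
Definition lbX (d1 d2 : int) (j : bool) (x : K) : K :=
  if j then x ^ (d1 + delta%:Z * d2) else x ^ d1.

Definition lbY (d2 : int) (y : K) : K := y ^ d2.

(* s is a global section of Theta (x) O(d1, d2) = Hom(O(-d1, -d2), Theta):
   on the chart c it is the vector field (s c)_0 d/dx + (s c)_1 d/dy times the
   generator of O(d1, d2). *)
Definition is_twisted_vf (d1 d2 : int) (s : chart -> 'cV[{mpoly K[2]}]_2) :
    Prop :=
  (forall (i j : bool) (x y : K), x != 0 ->
     jacX j x y *m map_mx (eval2 x y) (s (i, j)) =
     lbX d1 d2 j x *:
       map_mx (eval2 x^-1 (x ^ twist j * y)) (s (~~ i, j)))
  /\
  (forall (i j : bool) (x y : K), y != 0 ->
     jacY y *m map_mx (eval2 x y) (s (i, j)) =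
     lbY d2 y *: map_mx (eval2 x y^-1) (s (i, ~~ j))).

(* Phi is a global section of Hom(Theta, Theta), given on each chart by its
   matrix in the basis (d/dx, d/dy). *)
Definition is_tangent_endo (Phi : chart -> 'M[{mpoly K[2]}]_2) : Prop :=
  (forall (i j : bool) (x y : K), x != 0 ->
     jacX j x y *m map_mx (eval2 x y) (Phi (i, j)) =
     map_mx (eval2 x^-1 (x ^ twist j * y)) (Phi (~~ i, j)) *m jacX j x y)
  /\
  (forall (i j : bool) (x y : K), y != 0 ->
     jacY y *m map_mx (eval2 x y) (Phi (i, j)) =
     map_mx (eval2 x y^-1) (Phi (i, ~~ j)) *m jacY y).

Definition is_invertible_tangent_endo (Phi : chart -> 'M[{mpoly K[2]}]_2) :
    Prop :=
  is_tangent_endo Phi /\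
  exists Psi : chart -> 'M[{mpoly K[2]}]_2, is_tangent_endo Psi /\
    forall c, Phi c *m Psi c = 1%:M /\ Psi c *m Phi c = 1%:M.

Definition endo_act (Phi : chart -> 'M[{mpoly K[2]}]_2)
    (s : chart -> 'cV[{mpoly K[2]}]_2) : chart -> 'cV[{mpoly K[2]}]_2 :=
  fun c => Phi c *m s c.

(* A foliation with tangent sheaf O(-d1, -d2) is the class of a nonzero section
   under [same_foliation]. *)
Definition is_foliation (d1 d2 : int) (s : chart -> 'cV[{mpoly K[2]}]_2) :
    Prop :=
  is_twisted_vf d1 d2 s /\ exists c, s c != 0.

Definition same_foliation (s s' : chart -> 'cV[{mpoly K[2]}]_2) : Prop :=
  exists2 a : K, a != 0 & forall c, s' c = a%:MP *: s c.

(* The ideal of the singular scheme on the chart c, as a subset of C[x, y]. *)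
Definition sing_ideal (s : chart -> 'cV[{mpoly K[2]}]_2) (c : chart)
    (f : {mpoly K[2]}) : Prop :=
  exists a b : {mpoly K[2]}, f = a * s c ord0 ord0 + b * s c ord_max ord0.

Definition same_sing_scheme (s s' : chart -> 'cV[{mpoly K[2]}]_2) : Prop :=
  forall c f, sing_ideal s c f <-> sing_ideal s' c f.

Definition is_prime_ideal (p : {pred {mpoly K[2]}}) : Prop :=
  idealr_closed p /\ prime_idealr_closed p.

(* A strictly increasing chain p_0 < ... < p_n of prime ideals containing I,
   i.e. a chain of length n of irreducible closed subsets of V(I). *)
Definition has_prime_chain (I : {mpoly K[2]} -> Prop) (n : nat) : Prop :=
  exists p : nat -> {pred {mpoly K[2]}},
    (forall k, (k <= n)%N ->
       is_prime_ideal (p k) /\ forall f, I f -> f \in p k)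
    /\ (forall k, (k < n)%N ->
       {subset p k <= p k.+1} /\ exists2 f, f \in p k.+1 & f \notin p k).

Definition sing_dim (s : chart -> 'cV[{mpoly K[2]}]_2) (n : nat) : Prop :=
  (exists c, has_prime_chain (sing_ideal s c) n)
  /\ (forall c, ~ has_prime_chain (sing_ideal s c) n.+1).

Definition isolated_singularities (s : chart -> 'cV[{mpoly K[2]}]_2) : Prop :=
  sing_dim s 0.

(* Bi-homogeneous polynomials in C[X_0, X_1, Y_0, Y_1]. *)
Definition iX (i : bool) : 'I_4 :=
  if i then @Ordinal 4 1 isT else @Ordinal 4 0 isT.
Definition iY (j : bool) : 'I_4 :=
  if j then @Ordinal 4 3 isT else @Ordinal 4 2 isT.

Definition X0 : {mpoly K[4]} := 'X_(iX false).
Definition X1 : {mpoly K[4]} := 'X_(iX true).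
Definition Y0 : {mpoly K[4]} := 'X_(iY false).
Definition Y1 : {mpoly K[4]} := 'X_(iY true).

Definition bihomog (d1 d2 : int) (p : {mpoly K[4]}) : Prop :=
  forall m, m \in msupp p ->
    ((m (iX false))%:Z + (m (iX true))%:Z - delta%:Z * (m (iY true))%:Z = d1)
    /\ ((m (iY false))%:Z + (m (iY true))%:Z = d2).

(* 1-forms on C^4, as row vectors in the basis dX_0, dX_1, dY_0, dY_1. *)
Definition dX (i : bool) : 'rV[{mpoly K[4]}]_4 := delta_mx ord0 (iX i).
Definition dY (j : bool) : 'rV[{mpoly K[4]}]_4 := delta_mx ord0 (iY j).

Definition mk_form (A0 A1 B0 B1 : {mpoly K[4]}) : 'rV[{mpoly K[4]}]_4 :=
  A0 *: dX false + A1 *: dX true + B0 *: dY false + B1 *: dY true.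

Definition is_affine_form (d1 d2 : int) (Om : 'rV[{mpoly K[4]}]_4) : Prop :=
  let A i := Om ord0 (iX i) in
  let B j := Om ord0 (iY j) in
  [/\ (forall i, bihomog (d1 - delta%:Z + 1) (d2 + 2) (A i)),
      bihomog (d1 - delta%:Z + 2) (d2 + 1) (B false),
      bihomog (d1 + 2) (d2 + 1) (B true),
      X0 * A false + X1 * A true - delta%:R *: (Y1 * B true) = 0 &
      Y0 * B false + Y1 * B true = 0].

Definition chart_point (c : chart) : 4.-tuple {mpoly K[2]} :=
  [tuple (if c.1 then coord_x else 1); (if c.1 then 1 else coord_x);
         (if c.2 then coord_y else 1); (if c.2 then 1 else coord_y)].

(* On U_(i,j), contraction with 2-forms sends P d/dx + Q d/dy to P dy - Q dx, up
   to the sign (-1)^(i+j): the generator of Omega^2(2 - delta, 2), namely the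
   double contraction of dX_0 dX_1 dY_0 dY_1 with the two Euler vector fields
   X_0 d/dX_0 + X_1 d/dX_1 - delta Y_1 d/dY_1 and Y_0 d/dY_0 + Y_1 d/dY_1,
   restricts to -(-1)^(i+j) dx dy along X_i = Y_j = 1.  The restriction of Om
   there is A_(1-i) dx + B_(1-j) dy. *)
Definition represents (d1 d2 : int) (Om : 'rV[{mpoly K[4]}]_4)
    (s : chart -> 'cV[{mpoly K[2]}]_2) : Prop :=
  is_affine_form d1 d2 Om /\
  exists2 a : K, a != 0 & forall c : chart,
    (Om ord0 (iX (~~ c.1)) \mPo chart_point c =
       - (a * (-1) ^+ (c.1 + c.2)) *: s c ord_max ord0)
    /\ (Om ord0 (iY (~~ c.2)) \mPo chart_point c =
       (a * (-1) ^+ (c.1 + c.2)) *: s c ord0 ord0).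

End Hirzebruch.

(* Main.v *)
Require Import Defs.
From HB Require Import structures.
From mathcomp Require Import all_boot all_order all_algebra.
From mathcomp Require Import complex.
From mathcomp Require Import mpoly.
From mathcomp Require Import reals.
From mathcomp Require Import boolp zify ring.
Set Implicit Arguments.
Unset Strict Implicit.
Unset Printing Implicit Defensive.
Import Order.TTheory GRing.Theory Num.Theory.
Local Open Scope ring_scope.

(* On each chart write s = (P, Q) in the basis (d/dx, d/dy), d/dy being the
   vertical direction, and s' = (P', Q').  Isolated singularities mean that P, Q
   is a regular sequence, and equality of the singular schemes gives
   P' = m P + n Q locally.  The class of n on the curve {P = 0} does not depend
   on the choices, and is there a section of O(2 + delta, -2); its obstruction
   to vanish lies in H^1(O(delta - d1, - 2 - d2)), which is zero unless
   delta = 1 and d1 = 0, where it is killed because P does not vanish on the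
   exceptional curve.  Hence P divides P', and P' = a P with a constant.  In the
   same way Q' = m P + n Q where n restricts to a regular function on {P = 0},
   which is a constant e because H^1(O(- 2 - d1, - d2)) = 0, so that
   Q' = e Q + gamma P.  Comparing the charts, delta (a - e) = 0 and gamma is a
   section of O(- 2 - delta, 2), that is C(X_0, X_1) Y_1^2 with C of degree
   delta - 2.  Thus (P', Q') is the image of (P, Q) by the endomorphism with
   matrix (a, 0; gamma, e), and all endomorphisms of the tangent bundle have this
   form.  It is invertible because at a singular point neither of P, Q lies in
   the ideal generated by the other. *)

(** The tangent bundle is an extension of O(2, 0) by the vertical fields O(- delta, 2). So P is a
    section of O(2 + d1, d2), while Q is a section of O(d1 - delta, 2 + d2) only modulo P. This
    filtration dictates the order of the argument: P' can be compared on its own, and Q' only once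
    P' is a multiple of P, for then the correction terms of both Q and Q' are multiples of P. It
    also explains the twists: the coefficient n has the bidegree of P', respectively Q', minus that
    of Q, and the obstruction lies in H^1 after a further subtraction of the bidegree of P.

    The four charts share the torus xy != 0, which makes cohomology a matter of exponents of Laurent
    polynomials: being regular on a chart bounds the exponents, bounds from several charts can be
    intersected, and a group vanishes when no exponent is left. The obstacle is the case delta = 1,
    d1 = 0, where the single monomial y^(-1) survives. *)

Lemma mpoly_rmorph_eq (n : nat) (R S : comNzRingType)
    (f g : {rmorphism {mpoly R[n]} -> S}) :
    (forall c, f c%:MP = g c%:MP) -> (forall i, f 'X_i = g 'X_i) -> f =1 g.
Proof.
move=> fgC fgX p; rewrite [p]mpolyE !rmorph_sum; apply: eq_bigr => m _.
rewrite -mul_mpolyC !rmorphM fgC mpolyXE_id; congr (_ * _).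
by rewrite !rmorph_prod; apply: eq_bigr => i _; rewrite !rmorphXn fgX.
Qed.

(** * Regular pairs of bivariate polynomials *)

Section BivariateViews.
Variable K : numClosedFieldType.

(* [view true] is K[x, y] = K[y][x] and [view false] is K[x, y] = K[x][y]. *)
Definition view (b : bool) (p : {mpoly K[2]}) : {poly {poly K}} :=
  mmap (polyC \o polyC)
    (fun i : 'I_2 => if (i == ord0) == b then 'X else 'X%:P) p.
HB.instance Definition _ b := GRing.RMorphism.copy (view b) (view b).

Definition inj_var (i : 'I_2) : {poly K} -> {mpoly K[2]} :=
  horner_eval 'X_i \o map_poly (@mpolyC 2 K).
HB.instance Definition _ i := GRing.RMorphism.copy (inj_var i) (inj_var i).

Definition outer_var (b : bool) : 'I_2 := if b then ord0 else ord_max.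

Definition unview (b : bool) : {poly {poly K}} -> {mpoly K[2]} :=
  horner_eval 'X_(outer_var b) \o map_poly (inj_var (outer_var (~~ b))).
HB.instance Definition _ b := GRing.RMorphism.copy (unview b) (unview b).

Lemma inj_varC i c : inj_var i c%:P = c%:MP.
Proof. by rewrite /inj_var /= map_polyC /= /horner_eval hornerC. Qed.

Lemma inj_varX i : inj_var i 'X = 'X_i.
Proof. by rewrite /inj_var /= map_polyX /= /horner_eval hornerX. Qed.

Lemma unviewC b r : unview b r%:P = inj_var (outer_var (~~ b)) r.
Proof. by rewrite /unview /= map_polyC /= /horner_eval hornerC. Qed.

Lemma unviewX b : unview b 'X = 'X_(outer_var b).
Proof. by rewrite /unview /= map_polyX /= /horner_eval hornerX. Qed.

Lemma viewC b c : view b c%:MP = c%:P%:P.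
Proof. by rewrite /view mmapC. Qed.

Lemma viewX b i :
  view b 'X_i = if (i == ord0) == b then 'X else 'X%:P.
Proof. by rewrite /view mmapX mmap1U. Qed.

Lemma ord2P (i : 'I_2) : i = ord0 \/ i = ord_max.
Proof. by case: i => [[|[|//]] ?]; [left|right]; apply: val_inj. Qed.

Lemma viewK b : cancel (view b) (unview b).
Proof.
apply: (mpoly_rmorph_eq (f := unview b \o view b) (g := idfun)) => /= [c|i].
  by rewrite viewC unviewC inj_varC.
rewrite viewX; case: (ord2P i) => ->; case: b => /=.
- by rewrite unviewX.
- by rewrite unviewC inj_varX.
- by rewrite unviewC inj_varX.
- by rewrite unviewX.
Qed.

Lemma view_inj_inner b r : view b (inj_var (outer_var (~~ b)) r) = r%:P.
Proof.
elim/poly_ind: r => [|r c IH]; first by rewrite !rmorph0.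
rewrite !rmorphD !rmorphM /= IH inj_varX inj_varC viewC viewX.
by case: b {IH}.
Qed.

Lemma view_inj_outer b r : view b (inj_var (outer_var b) r) = map_poly polyC r.
Proof.
elim/poly_ind: r => [|r c IH]; first by rewrite !rmorph0.
rewrite !rmorphD !rmorphM /= IH inj_varX inj_varC viewC viewX.
by rewrite map_polyX map_polyC; case: b {IH}.
Qed.

HB.instance Definition _ x y := GRing.RMorphism.copy (@eval2 K x y)
  (meval (tnth [tuple x; y])).

Lemma eval2C (x y c : K) : eval2 x y c%:MP = c.
Proof. exact: mevalC. Qed.

Lemma eval2X (x y : K) i : eval2 x y 'X_i = if i == ord0 then x else y.
Proof. by rewrite /eval2 mevalXU; case: (ord2P i) => ->. Qed.

Lemma eval2_view b (x y : K) p :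
  eval2 x y p = (view b p).[(if b then x else y)%:P].[if b then y else x].
Proof.
pose e : {rmorphism {mpoly K[2]} -> K} :=
  horner_eval (if b then y else x) \o
  (horner_eval (if b then x else y)%:P \o view b).
apply: (mpoly_rmorph_eq (f := @eval2 K x y) (g := e)) => [c|i] /=.
  by rewrite viewC /horner_eval !hornerC eval2C.
rewrite eval2X viewX /horner_eval.
by case: (ord2P i) => ->; case: b {e} => /=; rewrite ?hornerX ?hornerC ?hornerX.
Qed.

(** Here [%|] is up to nonzero scalars of [T], hence divisibility over the fraction field. A divisor
    that is not associated to [g] has smaller size, which feeds the induction. *)
Lemma irreducible_factor (T : idomainType) (g : {poly T}) :
  (1 < size g)%N -> exists2 f, irreducible_poly f & f %| g.
Proof.
have [n] := ubnP (size g); elim: n g => // n IH g; rewrite ltnS => gn g1.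
have [irr|] := pselect (irreducible_poly g); first by exists g.
move=> nirr; have [q [q1 qg nqg]] : exists q : {poly T},
    [/\ size q != 1, q %| g & ~~ (q %= g)].
  apply: contrapT => h; apply: nirr; split=> // q q1 qg.
  by apply/negPn/negP => nqg; apply: h; exists q.
have g0 : g != 0 by rewrite -size_poly_gt0 ltnW.
have q0 : q != 0 by apply: contraTneq qg => ->; rewrite dvd0p.
have sq : (size q < size g)%N.
  rewrite ltn_neqAle dvdp_leq // andbT; apply: contra nqg.
  by rewrite dvdp_size_eqp.
have [||f irr fq] := IH q; first exact: leq_trans gn.
  by case: (size q) q1 (size_poly_gt0 q) => [|[|//]] //; rewrite q0.
by exists f => //; apply: dvdp_trans fq qg.
Qed.

Lemma eval2_prime_ideal (x y : K) :
  is_prime_ideal [pred f : {mpoly K[2]} | eval2 x y f == 0].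
Proof.
split; first split.
- by rewrite inE rmorph0.
- by rewrite inE rmorph1 oner_eq0.
- by move=> a u v; rewrite !inE rmorphD rmorphM /= => /eqP-> /eqP->; rewrite mulr0 addr0.
- by move=> u v; rewrite !inE rmorphM mulf_eq0.
Qed.

(** This is the contraction to K[x, y] of the prime ideal generated by [f0] over the fraction field
    of the inner variable. *)
Lemma irreducible_prime_ideal b (f0 : {poly {poly K}}) :
  irreducible_poly f0 ->
  is_prime_ideal [pred f : {mpoly K[2]} | f0 %| view b f].
Proof.
move=> irr; have [s1 _] := irr; split; first split.
- by rewrite inE rmorph0 dvdp0.
- by rewrite inE rmorph1 dvdp1; case: (size f0) s1 => [|[]].
- move=> a u v; rewrite !inE rmorphD rmorphM => fu fv.
  by rewrite dvdp_add // dvdp_mull.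
- move=> u v; rewrite !inE rmorphM.
  have [co|nco] := boolP (coprimep f0 (view b u)).
    by rewrite Gauss_dvdpr // => ->; rewrite orbT.
  move=> _; apply/orP; left.
  have := irr (gcdp f0 (view b u)) nco (dvdp_gcdl _ _).
  by move/eqp_dvdl <-; rewrite dvdp_gcdr.
Qed.

(* A common factor of P and Q over the fraction field of one of the variables
   yields a prime [p_0] containing no polynomial in that variable, hence not
   maximal: it is contained in the ideal of a point of the curve. *)
Lemma common_factor_prime_chain b (P Q : {mpoly K[2]})
    (I : {mpoly K[2]} -> Prop) :
  (forall f, I f -> exists u v, f = u * P + v * Q) ->
  ~~ coprimep (view b P) (view b Q) -> has_prime_chain I 1.
Proof.
move=> IPQ nco.
have [f0 irr /andP[f0P f0Q]] : exists2 f0 : {poly {poly K}}, irreducible_poly f0 &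
    (f0 %| view b P) && (f0 %| view b Q).
  set g := gcdp (view b P) (view b Q).
  have [g0|g0] := eqVneq g 0.
    (* Both polynomials are zero: any irreducible one divides them. *)
    exists ('X - 0%:P); first exact: irredp_XsubC.
    by rewrite -dvdp_gcd -/g g0 dvdp0.
  have [|f irr fg] := @irreducible_factor _ g.
    move: nco; rewrite coprimep_def -/g.
    by case: (size g) (size_poly_gt0 g) => [|[]] //; rewrite g0.
  by exists f; rewrite // -dvdp_gcd.
have [s1 _] := irr.
have f00 : f0 != 0 := irredp_neq0 irr.
(* The inner coordinate [v] avoids the zeros of the leading coefficient of [f0]. Specialisation then
   keeps the degree, so that a root [u] exists, and the power of this coefficient introduced by
   pseudo-division is nonzero at the point. *)
have /closed_nonrootP[v lv] : lead_coef f0 != 0 by rewrite lead_coef_eq0.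
have sf : (1 < size (map_poly (horner_eval v) f0))%N.
  by rewrite size_poly_eq // /horner_eval.
have /closed_rootP[u ru] : size (map_poly (horner_eval v) f0) != 1%N.
  by rewrite neq_ltn sf orbT.
have f0uv : f0.[u%:P].[v] = 0.
  transitivity (horner_eval v f0.[u%:P]); first by [].
  by rewrite -horner_map /= [horner_eval v _]hornerC; apply/eqP.
pose x := if b then u else v; pose y := if b then v else u.
pose p1 := [pred f : {mpoly K[2]} | eval2 x y f == 0].
pose p0 := [pred f : {mpoly K[2]} | f0 %| view b f].
have ev f : eval2 x y f = (view b f).[u%:P].[v].
  by rewrite (eval2_view b) /x /y; case: b {nco f0P f0Q x y p1 p0}.
have sub01 : {subset p0 <= p1}.
  move=> f; rewrite !inE => f0f; rewrite ev.
  have := Pdiv.Idomain.divp_eq (view b f) f0; rewrite (modp_eq0 f0f) addr0.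
  move/(congr1 (fun q => q.[u%:P].[v])); rewrite hornerZ !hornerM f0uv mulr0.
  move/eqP; rewrite mulf_eq0 => /orP[|//].
  by rewrite horner_exp expf_eq0 -rootE (negPf lv) andbF.
exists (fun k => if k is 0%N then p0 : {pred _} else p1); split.
- case=> [|[|//]] _; split.
  + exact: irreducible_prime_ideal.
  + move=> f /IPQ[a [c ->]]; rewrite inE rmorphD !rmorphM.
    by rewrite dvdp_add // dvdp_mull.
  + exact: eval2_prime_ideal.
  + move=> f /IPQ[a [c ->]]; apply: sub01; rewrite inE rmorphD !rmorphM.
    by rewrite dvdp_add // dvdp_mull.
- case=> [|//] _; split=> //.
  (* The equation of a line through the point: a nonzero constant in the outer variable, so not
     divisible by [f0]. *)
  exists (inj_var (outer_var (~~ b)) ('X - v%:P)).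
    by rewrite inE ev view_inj_inner hornerC hornerXsubC subrr.
  rewrite inE view_inj_inner; apply/negP => /dvdp_leq.
  rewrite polyC_eq0 polyXsubC_eq0 => /(_ isT).
  by rewrite size_polyC polyXsubC_eq0 leqNgt s1.
Qed.

(** The remainder of [m] by [r1], times the constant [r2], is a multiple of [r1] of smaller size
    than [r1], hence zero. *)
Lemma dvd_coprime_vars (T : idomainType) (r1 m k : {poly T}) (r2 : T) :
  lead_coef r1 \is a GRing.unit -> r2 != 0 -> m * r2%:P = k * r1 ->
  exists t, m = t * r1.
Proof.
move=> ur1 r20 e.
have r10 : r1 != 0.
  by rewrite -lead_coef_eq0; apply: contraTneq ur1 => ->; rewrite unitr0.
have dm := Pdiv.IdomainUnit.divp_eq ur1 m.
exists (m %/ r1); rewrite {1}dm; suff -> : m %% r1 = 0 by rewrite addr0.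
have e' : (m %% r1) * r2%:P = (k - (m %/ r1) * r2%:P) * r1.
  by rewrite mulrBl -e {2}dm mulrDl; ring.
apply/eqP; apply: contraT => rm0.
have k0 : k - (m %/ r1) * r2%:P != 0.
  apply/eqP => k0; move/eqP: e'; rewrite k0 mul0r mulf_eq0 polyC_eq0.
  by rewrite (negPf rm0) (negPf r20).
have := ltn_modp m r1; rewrite r10 -(size_scale (m %% r1) r20) -mul_polyC.
rewrite [r2%:P * _]mulrC e'.
rewrite size_mul // ltnNge; case: (size _) (size_poly_gt0 (k - m %/ r1 * r2%:P)).
  by rewrite k0.
by move=> n _; rewrite addSn /= leq_addl.
Qed.

(* (P, Q) is a regular sequence or generates the unit ideal. *)
Definition regular_pair (P Q : {mpoly K[2]}) : Prop :=
  forall u v, u * P = v * Q -> exists2 t, u = t * Q & v = t * P.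

(** Without a chain, [P] and [Q] are coprime over both fraction fields, so Bezout puts a nonzero
    [r1] in x alone and a nonzero [r2] in y alone into the ideal (P, Q). Each of them clears the
    denominator of the wanted quotient [t]; as they share no variable, [t] is a polynomial. *)
Lemma no_chain_regular_pair (P Q : {mpoly K[2]}) (I : {mpoly K[2]} -> Prop) :
  (forall f, I f -> exists u v, f = u * P + v * Q) ->
  ~ has_prime_chain I 1 -> regular_pair P Q.
Proof.
move=> IPQ nch.
have bez b : exists u1 u2 (r : {poly K}), r != 0 /\
    u1 * P + u2 * Q = inj_var (outer_var (~~ b)) r.
  have /Bezout_coprimepP[[u1 u2] /=] : coprimep (view b P) (view b Q).
    by apply: contrapT => /negP /(common_factor_prime_chain IPQ).
  rewrite -size_poly_eq1 => /size_poly1P[r r0 e].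
  exists (unview b u1), (unview b u2), r; split=> //.
  rewrite -[P in LHS](viewK b) -[Q in LHS](viewK b) -!rmorphM -rmorphD.
  by rewrite e /= unviewC.
have [u1 [u2 [r1 [r10 e1]]]] := bez false.
have [u3 [u4 [r2 [r20 e2]]]] := bez true.
move=> a c ac.
set R1 := inj_var _ r1 in e1; set R2 := inj_var _ r2 in e2.
have vR1 : view true R1 = map_poly polyC r1 by exact: (view_inj_outer true).
have vR2 : view true R2 = r2%:P by exact: (view_inj_inner true).
have R10 : R1 != 0.
  apply/eqP => /(congr1 (view true)) /eqP; rewrite vR1 rmorph0.
  by rewrite map_poly_eq0_id0 ?(negPf r10) // polyC_eq0 lead_coef_eq0.
(* These are [r1] and [r2] times the quotient [t] to be found. *)
set m1 := u1 * c + u2 * a; set m2 := u3 * c + u4 * a.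
have a1 : R1 * a = Q * m1.
  rewrite -e1 /m1; transitivity (u1 * (a * P) + u2 * Q * a); first by ring.
  by rewrite ac; ring.
have c1 : R1 * c = P * m1.
  rewrite -e1 /m1; transitivity (u1 * P * c + u2 * (c * Q)); first by ring.
  by rewrite -ac; ring.
have a2 : R2 * a = Q * m2.
  rewrite -e2 /m2; transitivity (u3 * (a * P) + u4 * Q * a); first by ring.
  by rewrite ac; ring.
have c2 : R2 * c = P * m2.
  rewrite -e2 /m2; transitivity (u3 * P * c + u4 * (c * Q)); first by ring.
  by rewrite -ac; ring.
have e12 : m1 * R2 = m2 * R1.
  have [P0|P0] := eqVneq P 0.
    have Q0 : Q != 0 by apply: contraNneq R10 => Q0; rewrite -e1 P0 Q0 !mulr0 addr0.
    apply: (mulfI Q0); rewrite !mulrA -a1 -a2; ring.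
  apply: (mulfI P0); rewrite !mulrA -c1 -c2; ring.
have [|||t te] := @dvd_coprime_vars _ (view true R1) (view true m1) (view true m2) r2.
- rewrite vR1 lead_coef_map_inj //; last exact: polyC_inj.
  by rewrite poly_unitE size_polyC coefC /= unitfE lead_coef_eq0 r10.
- exact: r20.
- by rewrite -vR2 -!rmorphM e12.
have mt : m1 = unview true t * R1.
  by rewrite -[m1](viewK true) te rmorphM /= viewK.
exists (unview true t); apply: (mulfI R10).
  by rewrite a1 mt; ring.
by rewrite c1 mt; ring.
Qed.
End BivariateViews.

(** * Laurent polynomials on the torus *)

Section LaurentFunctions.
Variable K : numClosedFieldType.

(* Sections over the overlaps are compared as functions on the torus
   {x != 0, y != 0}; their values outside of it are irrelevant. *)
Definition teq (f g : K -> K -> K) : Prop :=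
  forall x y, x != 0 -> y != 0 -> f x y = g x y.

(* On the torus, f is a Laurent polynomial with exponents in A. *)
Definition laurent (A : int -> int -> bool) (f : K -> K -> K) : Prop :=
  exists2 l : seq (K * (int * int)), all (fun t => A t.2.1 t.2.2) l &
    teq f (fun x y => \sum_(t <- l) t.1 * x ^ t.2.1 * y ^ t.2.2).

Lemma laurent_ext A f g : teq g f -> laurent A f -> laurent A g.
Proof. by move=> gf [l lA fl]; exists l => // x y x0 y0; rewrite gf ?fl. Qed.

Lemma laurent_sub (A B : int -> int -> bool) f :
  (forall p q, A p q -> B p q) -> laurent A f -> laurent B f.
Proof.
by move=> AB [l lA fl]; exists l => //; apply: sub_all lA => t; apply: AB.
Qed.

Lemma laurent0 A : laurent A (fun _ _ => 0).
Proof. by exists [::] => // x y _ _; rewrite big_nil. Qed.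

Lemma laurent_mon (A : int -> int -> bool) c p q :
  A p q -> laurent A (fun x y => c * x ^ p * y ^ q).
Proof.
by move=> Apq; exists [:: (c, (p, q))]; rewrite /= ?Apq // => x y _ _; rewrite big_seq1.
Qed.

Lemma laurentD A f g :
  laurent A f -> laurent A g -> laurent A (fun x y => f x y + g x y).
Proof.
move=> [l lA fl] [m mA gm]; exists (l ++ m); first by rewrite all_cat lA.
by move=> x y x0 y0; rewrite big_cat /= fl ?gm.
Qed.

Lemma laurentM (A B C : int -> int -> bool) f g :
  (forall p q p' q', A p q -> B p' q' -> C (p + p') (q + q')) ->
  laurent A f -> laurent B g -> laurent C (fun x y => f x y * g x y).
Proof.
move=> ABC [l lA fl] [m mB gm].
exists [seq (t.1 * u.1, (t.2.1 + u.2.1, t.2.2 + u.2.2)) | t <- l, u <- m].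
  apply/allP => _ /allpairsP[[t u] /= [tl um ->]] /=; apply: ABC.
    exact: (allP lA).
  exact: (allP mB).
move=> x y x0 y0; rewrite fl ?gm // big_allpairs_dep /= mulr_suml.
apply: eq_bigr => t _; rewrite mulr_sumr; apply: eq_bigr => u _ /=.
by rewrite !expfzDr //; ring.
Qed.

Lemma laurentN A f : laurent A f -> laurent A (fun x y => - f x y).
Proof.
move=> /(laurentM (A := fun p q => (p == 0) && (q == 0)) (C := A) _).
move/(_ (fun _ _ => -1)) => h.
apply: (laurent_ext (f := fun x y => -1 * f x y)); last first.
  apply: h; last first.
    by exists [:: (-1, (0, 0))] => // x y _ _; rewrite big_seq1 !expr0z !mulr1.
  by move=> p q p' q' /andP[/eqP-> /eqP->]; rewrite !add0r.
by move=> x y _ _; rewrite mulN1r.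
Qed.

Lemma laurentB A f g :
  laurent A f -> laurent A g -> laurent A (fun x y => f x y - g x y).
Proof. by move=> fA /laurentN gA; apply: laurentD. Qed.

Lemma laurent_split (A B : int -> int -> bool) f : laurent A f ->
  exists g h, [/\ laurent (fun p q => A p q && B p q) g,
    laurent (fun p q => A p q && ~~ B p q) h &
    teq f (fun x y => g x y + h x y)].
Proof.
move=> [l /allP lA fl].
exists (fun x y => \sum_(t <- [seq t <- l | B t.2.1 t.2.2]) t.1 * x ^ t.2.1 * y ^ t.2.2).
exists (fun x y => \sum_(t <- [seq t <- l | ~~ B t.2.1 t.2.2]) t.1 * x ^ t.2.1 * y ^ t.2.2).
split.
- exists [seq t <- l | B t.2.1 t.2.2] => //.
  by apply/allP => t; rewrite mem_filter => /andP[-> /lA ->].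
- exists [seq t <- l | ~~ B t.2.1 t.2.2] => //.
  by apply/allP => t; rewrite mem_filter => /andP[-> /lA ->].
- by move=> x y x0 y0; rewrite fl // !big_filter (bigID (fun t => B t.2.1 t.2.2)).
Qed.

Lemma poly_torus0 (p : {poly K}) : (forall x, x != 0 -> p.[x] = 0) -> p = 0.
Proof.
move=> h; suff : p * 'X = 0 by move/eqP; rewrite mulf_eq0 polyX_eq0 orbF => /eqP.
apply/eqP; apply: contraT => /closed_nonrootP[x]; rewrite /root hornerM hornerX.
by have [->|/h ->] := eqVneq x 0; rewrite ?mulr0 ?mul0r eqxx.
Qed.

Lemma eval2_torus_inj (f g : {mpoly K[2]}) :
  teq (fun x y => eval2 x y f) (fun x y => eval2 x y g) -> f = g.
Proof.
move=> fg; apply/eqP; rewrite -subr_eq0; apply/eqP; apply: (can_inj (viewK true)).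
rewrite rmorph0; set q := view true _.
have q0 x y : x != 0 -> y != 0 -> q.[x%:P].[y] = 0.
  by move=> x0 y0; rewrite -(eval2_view true x y) rmorphB /= fg ?subrr.
apply/polyP => i; rewrite coef0; apply: poly_torus0 => y y0.
have : map_poly (horner_eval y) q = 0.
  apply: poly_torus0 => x x0.
  by rewrite -[x in LHS](hornerC x y) -[_.[y]]/(horner_eval y _) horner_map /= [LHS]q0.
by move/(congr1 (fun r : {poly K} => r`_i)); rewrite coef_map coef0.
Qed.

Definition nonneg_supp (p q : int) := (0 <= p) && (0 <= q).

Lemma laurent_eval2 (f : {mpoly K[2]}) :
  laurent nonneg_supp (fun x y => eval2 x y f).
Proof.
exists [seq (f@_m, ((m ord0)%:Z, (m ord_max)%:Z)) | m <- msupp f].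
  by apply/allP => _ /mapP[m _ ->].
move=> x y _ _; rewrite big_map /eval2 mevalE; apply: eq_bigr => m _ /=.
rewrite big_ord_recl big_ord1 mulrA; congr (_ * _ ^+ _ * _ ^+ _) => //.
by congr (m _); apply: val_inj.
Qed.

Lemma laurent_poly f : laurent nonneg_supp f ->
  exists p : {mpoly K[2]}, teq f (fun x y => eval2 x y p).
Proof.
move=> [l lA fl].
exists (\sum_(t <- l) t.1%:MP * 'X_ord0 ^+ `|t.2.1|%N * 'X_ord_max ^+ `|t.2.2|%N).
move=> x y x0 y0; rewrite fl // rmorph_sum /= big_seq [RHS]big_seq.
apply: eq_bigr => t /(allP lA) /andP[t1 t2].
rewrite !rmorphM !rmorphXn /= eval2C !eval2X /=.
by rewrite !exprnP !gez0_abs.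
Qed.

Lemma exponents_bound (l : seq (K * (int * int))) : exists N : nat,
  forall t, t \in l -> (- N%:Z <= t.2.1) && (- N%:Z <= t.2.2).
Proof.
elim: l => [|[c [p q]] l [N IH]]; first by exists 0%N.
exists (N + `|p| + `|q|)%N => -[c' [p' q']]; rewrite inE => /predU1P[|/IH] /=.
  by case=> _ -> ->; lia.
lia.
Qed.

Lemma laurent_bound A f : laurent A f -> exists N : nat,
  laurent (fun p q => [&& A p q, - N%:Z <= p & - N%:Z <= q]) f.
Proof.
move=> [l lA fl]; have [N hN] := exponents_bound l.
exists N; exists l => //; apply/allP => t tl.
by rewrite (allP lA) // hN.
Qed.

(** A power of xy turns the sum into a polynomial that vanishes on the torus, hence has zero
    coefficients. *)
Lemma laurent_indep (l : seq (K * (int * int))) (e : int * int) :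
  teq (fun x y => \sum_(t <- l) t.1 * x ^ t.2.1 * y ^ t.2.2) (fun _ _ => 0) ->
  \sum_(t <- l | t.2 == e) t.1 = 0.
Proof.
move=> l0; have [N hN] := exponents_bound ((0, e) :: l).
pose mm (u : int * int) : 'X_{1..2} :=
  (U_(ord0) *+ absz (N%:Z + u.1)%R + U_(ord_max) *+ absz (N%:Z + u.2)%R)%MM.
have p0 : \sum_(t <- l) t.1 *: 'X_[mm t.2] = 0 :> {mpoly K[2]}.
  apply: eval2_torus_inj => x y x0 y0.
  have := congr1 ( *%R ((x * y) ^+ N)) (l0 x y x0 y0).
  rewrite mulr0 mulr_sumr rmorph0 rmorph_sum /= => e0.
  rewrite -[RHS]e0 big_seq [RHS]big_seq; apply: eq_bigr => t tl.
  have /andP[t1 t2] := hN t (mem_behead (s := _ :: _) tl).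
  rewrite -mul_mpolyC /mm mpolyXD -!mpolyXn !rmorphM !rmorphXn /= eval2C !eval2X /=.
  rewrite exprMn !exprnP !gez0_abs ?expfzDr -?lerBlDl ?sub0r //; ring.
have := congr1 (mcoeff (mm e)) p0; rewrite mcoeff0 raddf_sum /= => e0.
rewrite -[RHS]e0 big_mkcond big_seq [RHS]big_seq; apply: eq_bigr => t tl.
rewrite mcoeffZ mcoeffX; have [->|te] := eqVneq t.2 e; first by rewrite eqxx mulr1.
suff /negPf-> : mm t.2 != mm e by rewrite mulr0.
apply: contraNneq te => /mnmP mte; apply/eqP.
have := hN t (mem_behead (s := _ :: _) tl).
have := hN (0, e) (mem_head _ _); move: (mte ord0) (mte ord_max).
rewrite !mnmDE !mulmnE !mnm1E /=.
by case: (t.2) => p q; case: e {l0 hN p0 mte e0} => p' q' /= *; congr pair; lia.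
Qed.

Lemma laurent_part (B : int -> int -> bool) (l : seq (K * (int * int))) :
  teq (fun x y => \sum_(t <- l) t.1 * x ^ t.2.1 * y ^ t.2.2) (fun _ _ => 0) ->
  teq (fun x y => \sum_(t <- l | B t.2.1 t.2.2) t.1 * x ^ t.2.1 * y ^ t.2.2)
      (fun _ _ => 0).
Proof.
move=> l0 x y x0 y0; pose E := undup [seq t.2 | t <- l].
transitivity (\sum_(t <- l | B t.2.1 t.2.2) \sum_(e <- E | t.2 == e)
    t.1 * x ^ e.1 * y ^ e.2).
  rewrite big_seq_cond [RHS]big_seq_cond; apply: eq_bigr => t /andP[tl _].
  rewrite (eq_bigl (pred1 t.2)) => [|e]; last by rewrite eq_sym.
  by rewrite -big_filter filter_pred1_uniq ?undup_uniq ?mem_undup ?map_f // big_seq1.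
rewrite (exchange_big_dep (fun e : int * int => B e.1 e.2)) /=; last first.
  by move=> t e Bt /eqP <-.
rewrite big1 // => e Be.
rewrite (eq_bigl (fun t => t.2 == e)) => [|t]; last first.
  by case: eqP => [->|]; rewrite ?Be ?andbF.
by rewrite -!mulr_suml laurent_indep // !mul0r.
Qed.

(** Laurent expansions on the torus are unique, so the terms outside [B] of the expansion supported
    by [A] cancel. This is what allows bounds read off on different charts to be combined. *)
Lemma laurentI A B f : laurent A f -> laurent B f ->
  laurent (fun p q => A p q && B p q) f.
Proof.
move=> [l lA fl] [m mB fm]; exists [seq t <- l | B t.2.1 t.2.2].
  by apply/allP => t; rewrite mem_filter => /andP[-> /(allP lA) ->].
pose m' := [seq (- t.1, t.2) | t <- m].
have lm : teq (fun x y => \sum_(t <- l ++ m') t.1 * x ^ t.2.1 * y ^ t.2.2) (fun _ _ => 0).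
  move=> x y x0 y0; rewrite big_cat big_map /= -fl // fm // -big_split big1 // => t _.
  by rewrite /= !mulNr subrr.
move=> x y x0 y0; have := laurent_part B lm x0 y0.
rewrite big_cat big_map /= big_filter => /eqP; rewrite addr_eq0 => /eqP ->.
rewrite fm // -sumrN [RHS]big_mkcond /= big_seq [RHS]big_seq.
by apply: eq_bigr => t /(allP mB) ->; rewrite !mulNr opprK.
Qed.

Lemma laurent_empty A f : (forall p q, ~~ A p q) -> laurent A f ->
  teq f (fun _ _ => 0).
Proof.
move=> A0 [[|t l] /= lA fl x y x0 y0]; first by rewrite fl // big_nil.
by case/andP: lA => h; have := A0 t.2.1 t.2.2; rewrite h.
Qed.

Lemma laurent_comp (A B : int -> int -> bool) (a c d : int) f u v :
  (forall p q, A p q -> B (a * p + c * q) (d * q)) ->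
  teq u (fun x _ => x ^ a) -> teq v (fun x y => x ^ c * y ^ d) ->
  laurent A f -> laurent B (fun x y => f (u x y) (v x y)).
Proof.
move=> AB ue ve [l lA fl].
exists [seq (t.1, (a * t.2.1 + c * t.2.2, d * t.2.2)) | t <- l].
  by apply/allP => _ /mapP[t /(allP lA) tA ->] /=; apply: AB.
move=> x y x0 y0; rewrite ue // ve // fl ?mulf_neq0 ?expfz_neq0 //.
rewrite big_map; apply: eq_bigr => t _ /=.
by rewrite expfzMl expfzDr // !exprz_exp; ring.
Qed.

Definition torus_nonzero (f : K -> K -> K) : Prop :=
  exists x y, [/\ x != 0, y != 0 & f x y != 0].

Lemma laurent_clear A f : laurent A f -> exists N : nat, exists p : {mpoly K[2]},
  teq (fun x y => (x * y) ^+ N * f x y) (fun x y => eval2 x y p).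
Proof.
move=> /laurent_bound[N fN]; exists N; apply: laurent_poly.
have := laurent_mon (A := fun p q => (p == N%:Z) && (q == N%:Z)) 1 (p := N) (q := N).
rewrite !eqxx => /(_ isT) /laurentM /(_ fN).
move=> /(_ nonneg_supp) h; apply: laurent_ext (h _).
  by move=> x y x0 y0; rewrite exprMn !exprnP mul1r.
by rewrite /nonneg_supp; lia.
Qed.

(** Laurent polynomials form a domain: powers of xy reduce the product to one of polynomials. *)
Lemma laurent_cancel A B P g : laurent A P -> torus_nonzero P -> laurent B g ->
  teq (fun x y => P x y * g x y) (fun _ _ => 0) -> teq g (fun _ _ => 0).
Proof.
move=> /laurent_clear[N [p pe]] [x1 [y1 [x10 y10 P1]]] /laurent_clear[M [q qe]] Pg.
have pq : p * q = 0.
  apply: eval2_torus_inj => x y x0 y0; rewrite rmorph0 rmorphM /= -pe // -qe //.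
  by rewrite mulrACA Pg // mulr0.
have p0 : p != 0.
  apply: contraNneq P1 => p0; have := pe x1 y1 x10 y10.
  rewrite p0 rmorph0 => /eqP.
  by rewrite mulf_eq0 expf_eq0 mulf_eq0 (negPf x10) (negPf y10) andbF.
move/eqP: pq; rewrite mulf_eq0 (negPf p0) => /eqP q0 x y x0 y0.
have := qe x y x0 y0; rewrite q0 rmorph0 => /eqP.
by rewrite mulf_eq0 expf_eq0 mulf_eq0 (negPf x0) (negPf y0) andbF => /eqP.
Qed.
Lemma laurent_scale (A B : int -> int -> bool) (c : K) a b f :
  (forall p q, A p q -> B (a + p) (b + q)) -> laurent A f ->
  laurent B (fun x y => c * x ^ a * y ^ b * f x y).
Proof.
move=> AB fA; pose M p q := (p == a) && (q == b).
have h : laurent M (fun x y => c * x ^ a * y ^ b).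
  by apply: laurent_mon; rewrite /M !eqxx.
by apply: laurentM h fA => p q p' q' /andP[/eqP-> /eqP->]; apply: AB.
Qed.

Lemma laurent_scalex (A B : int -> int -> bool) (c : K) a f :
  (forall p q, A p q -> B (a + p) q) -> laurent A f ->
  laurent B (fun x y => c * x ^ a * f x y).
Proof.
move=> AB fA; apply: (laurent_ext (f := fun x y => c * x ^ a * y ^ 0 * f x y)).
  by move=> x y _ _; rewrite expr0z mulr1.
by apply: laurent_scale fA => p q /AB; rewrite add0r.
Qed.

Lemma laurent_scaley (A B : int -> int -> bool) (c : K) b f :
  (forall p q, A p q -> B p (b + q)) -> laurent A f ->
  laurent B (fun x y => c * y ^ b * f x y).
Proof.
move=> AB fA; apply: (laurent_ext (f := fun x y => c * x ^ 0 * y ^ b * f x y)).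
  by move=> x y _ _; rewrite expr0z mulr1.
by apply: laurent_scale fA => p q /AB; rewrite add0r.
Qed.
Lemma laurent_monx (A : int -> int -> bool) p : A p 0 ->
  laurent A (fun x _ : K => x ^ p).
Proof.
move=> Ap; apply: (laurent_ext (f := fun x y => 1 * x ^ p * y ^ 0)).
  by move=> x y _ _; rewrite mul1r expr0z mulr1.
exact: laurent_mon.
Qed.

Lemma laurent_mony (A : int -> int -> bool) q : A 0 q ->
  laurent A (fun _ y : K => y ^ q).
Proof.
move=> Ap; apply: (laurent_ext (f := fun x y => 1 * x ^ 0 * y ^ q)).
  by move=> x y _ _; rewrite mul1r expr0z mul1r.
exact: laurent_mon.
Qed.

Lemma laurent_cst (A : int -> int -> bool) (c : K) : A 0 0 ->
  laurent A (fun _ _ => c).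
Proof.
move=> A0; apply: (laurent_ext (f := fun x y => c * x ^ 0 * y ^ 0)).
  by move=> x y _ _; rewrite !expr0z !mulr1.
exact: laurent_mon.
Qed.

Lemma laurent_const (f : K -> K -> K) :
  laurent (fun p q => (p == 0) && (q == 0)) f -> exists a, teq f (fun _ _ => a).
Proof.
move=> [l lA fl]; exists (\sum_(t <- l) t.1) => x y x0 y0; rewrite fl //.
rewrite big_seq [RHS]big_seq; apply: eq_bigr => t /(allP lA) /andP[/eqP-> /eqP->].
by rewrite !expr0z !mulr1.
Qed.

Lemma eval2_torus_nonzero (f : {mpoly K[2]}) :
  f != 0 -> torus_nonzero (fun x y => eval2 x y f).
Proof.
move=> f0; apply: contrapT => h; move/eqP: f0; apply.
apply: eval2_torus_inj => x y x0 y0; rewrite rmorph0; apply/eqP.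
by apply: contraT => fxy; case: h; exists x, y.
Qed.

Lemma laurent_eq_cancel A B (f : {mpoly K[2]}) g h : f != 0 ->
  laurent A g -> laurent B h ->
  teq (fun x y => eval2 x y f * g x y) (fun x y => eval2 x y f * h x y) -> teq g h.
Proof.
move=> /eval2_torus_nonzero f0 Ag Bh e x y x0 y0; apply/eqP; rewrite -subr_eq0; apply/eqP.
apply: (laurent_cancel (laurent_eval2 f) f0 (B := fun _ _ => true)
  (g := fun x y => g x y - h x y)) => //.
  by apply: laurentB; [apply: laurent_sub Ag|apply: laurent_sub Bh].
by move=> {}x {}y {}x0 {}y0; rewrite mulrBr e // subrr.
Qed.

End LaurentFunctions.

(* Cech computation in the coordinates of the chart (0,0).  The b_ij lift a
   section of O(A, B) on the curve {P = 0}, P in O(D1, D2), and P h_k are the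
   differences on overlaps.  The class of (h_k) in H^1(O(A - D1, B - D2)) has
   its exponents in the range of the last hypothesis, which kills it; the lifts
   can then be corrected to a global section g. *)
Lemma laurent_glue (K : numClosedFieldType) (delta : nat) (A B D1 D2 : int)
    (P b00 b01 b10 b11 h1 h2 h3 h4 : K -> K -> K) :
  laurent (fun p q => [&& 0 <= p, p <= delta%:Z * q + D1, 0 <= q & q <= D2]) P ->
  torus_nonzero P ->
  laurent (fun p q => (0 <= p) && (0 <= q)) b00 ->
  laurent (fun p q => (0 <= p) && (q <= B)) b01 ->
  laurent (fun p q => (p <= delta%:Z * q + A) && (0 <= q)) b10 ->
  laurent (fun p q => (p <= delta%:Z * q + A) && (q <= B)) b11 ->
  laurent (fun p q => 0 <= p) h1 ->
  laurent (fun p q => p <= delta%:Z * q + A - D1) h2 ->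
  laurent (fun p q => 0 <= q) h3 ->
  laurent (fun p q => q <= B - D2) h4 ->
  teq (fun x y => b00 x y - b01 x y) (fun x y => P x y * h1 x y) ->
  teq (fun x y => b10 x y - b11 x y) (fun x y => P x y * h2 x y) ->
  teq (fun x y => b00 x y - b10 x y) (fun x y => P x y * h3 x y) ->
  teq (fun x y => b01 x y - b11 x y) (fun x y => P x y * h4 x y) ->
  B < D2 ->
  (forall m, laurent (fun p q => [&& 0 <= p, p <= delta%:Z * q + A - D1,
                                     B - D2 < q & q < 0]) m ->
     laurent (fun p q => (0 <= q) || (q <= B)) (fun x y => P x y * m x y) ->
     teq m (fun _ _ => 0)) ->
  exists g k00 k01 k10,
  [/\ laurent (fun p q => [&& 0 <= p, p <= delta%:Z * q + A, 0 <= q & q <= B]) g,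
      laurent (fun p q => (0 <= p) && (0 <= q)) k00 /\
        teq b00 (fun x y => g x y + P x y * k00 x y),
      laurent (fun p q => (0 <= p) && (q <= B - D2)) k01 /\
        teq b01 (fun x y => g x y + P x y * k01 x y) &
      laurent (fun p q => (p <= delta%:Z * q + A - D1) && (0 <= q)) k10 /\
        teq b10 (fun x y => g x y + P x y * k10 x y)].
Proof.
move=> LP P0 L00 L01 L10 L11 Lh1 Lh2 Lh3 Lh4 e1 e2 e3 e4 BD Hmid.
(* The cocycle relation of (h_k), obtained by cancelling [P]. *)
have hsum : teq (fun x y => h1 x y - h2 x y - h3 x y + h4 x y) (fun _ _ => 0).
  have Lall f (C : int -> int -> bool) : laurent C f -> laurent (fun _ _ => true) f.
    exact: laurent_sub.
  apply: (laurent_cancel LP P0 (B := fun _ _ => true)).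
    apply: laurentD; last exact: Lall Lh4.
    apply: laurentB; last exact: Lall Lh3.
    by apply: laurentB; [exact: Lall Lh1|exact: Lall Lh2].
  move=> x y x0 y0; rewrite mulrDr !mulrBr -e1 // -e2 // -e3 // -e4 //; ring.
(* By their y-exponents, [h1] and [h2] split into a part absorbed by the charts with j = 0, a part
   absorbed by those with j = 1, and a middle part that carries the class in H^1. *)
have [h1p [h1' [Lh1p Lh1' eh1]]] := laurent_split (fun p q => 0 <= q) Lh1.
have [h1n [h1m [Lh1n Lh1m eh1']]] := laurent_split (fun p q => q <= B - D2) Lh1'.
have [h2p [h2' [Lh2p Lh2' eh2]]] := laurent_split (fun p q => 0 <= q) Lh2.
have [h2n [h2m [Lh2n Lh2m eh2']]] := laurent_split (fun p q => q <= B - D2) Lh2'.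
have {}eh1 x y : x != 0 -> y != 0 -> h1 x y = h1p x y + h1n x y + h1m x y.
  by move=> x0 y0; rewrite eh1 // eh1' // addrA.
have {}eh2 x y : x != 0 -> y != 0 -> h2 x y = h2p x y + h2n x y + h2m x y.
  by move=> x0 y0; rewrite eh2 // eh2' // addrA.
have e12 x y : x != 0 -> y != 0 -> h3 x y - h4 x y = h1 x y - h2 x y.
  move=> x0 y0; rewrite -[RHS]subr0 -(hsum x y x0 y0); ring.
(* [h3] and [h4] have no exponent in the middle range, so the cocycle relation identifies the two
   middle parts. *)
have m12 : teq h1m h2m.
  pose d x y := h1m x y - h2m x y.
  suff d0 : teq d (fun _ _ => 0).
    by move=> x y x0 y0; apply/eqP; rewrite -subr_eq0 -/(d x y) d0.
  pose C (p q : int) := (0 <= q) || (q <= B - D2).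
  apply: (laurent_empty (A := fun p q => (~~ C p q) && C p q)) => [p q|].
    by rewrite andNb.
  apply: laurentI.
    by apply: laurentB; [apply: laurent_sub Lh1m|apply: laurent_sub Lh2m]; rewrite /C; lia.
  apply: (laurent_ext (f := fun x y => h3 x y - h4 x y - (h1p x y + h1n x y) +
      (h2p x y + h2n x y))).
    by move=> x y x0 y0; rewrite e12 // eh1 // eh2 // /d; ring.
  apply: laurentD; first apply: laurentB.
  - by apply: laurentB; [apply: laurent_sub Lh3|apply: laurent_sub Lh4]; rewrite /C; lia.
  - by apply: laurentD; [apply: laurent_sub Lh1p|apply: laurent_sub Lh1n]; rewrite /C; lia.
  - by apply: laurentD; [apply: laurent_sub Lh2p|apply: laurent_sub Lh2n]; rewrite /C; lia.
have eb01 x y : x != 0 -> y != 0 -> b01 x y = b00 x y - P x y * h1 x y.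
  by move=> x0 y0; rewrite -e1 //; ring.
have eb11 x y : x != 0 -> y != 0 -> b11 x y = b10 x y - P x y * h2 x y.
  by move=> x0 y0; rewrite -e2 //; ring.
(* [P] times the middle part is a difference of two corrected lifts, one with exponents q >= 0, the
   other with q <= B: this is the second premise of [Hmid]. *)
have m0 : teq h1m (fun _ _ => 0).
  apply: Hmid.
    apply: laurent_sub (laurentI Lh1m (laurent_ext m12 Lh2m)); lia.
  apply: (laurent_ext (f := fun x y => (b00 x y - P x y * h1p x y) -
      (b01 x y + P x y * h1n x y))).
    by move=> x y x0 y0; rewrite eb01 // eh1 //; ring.
  apply: laurentB; [apply: laurentB|apply: laurentD].
  - by apply: laurent_sub L00; lia.
  - by apply: laurentM LP Lh1p; lia.
  - by apply: laurent_sub L01; lia.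
  - by apply: laurentM LP Lh1n; lia.
have {}eh1 x y : x != 0 -> y != 0 -> h1 x y = h1p x y + h1n x y.
  by move=> x0 y0; rewrite eh1 // m0 // addr0.
have {}eh2 x y : x != 0 -> y != 0 -> h2 x y = h2p x y + h2n x y.
  by move=> x0 y0; rewrite eh2 // -m12 // m0 // addr0.
pose g1 x y := b00 x y - P x y * h1p x y.
pose g2 x y := b10 x y - P x y * h2p x y.
have g1e : teq g1 (fun x y => b01 x y + P x y * h1n x y).
  by move=> x y x0 y0; rewrite /g1 eb01 // eh1 //; ring.
have g2e : teq g2 (fun x y => b11 x y + P x y * h2n x y).
  by move=> x y x0 y0; rewrite /g2 eb11 // eh2 //; ring.
have Lg1 : laurent (fun p q => [&& 0 <= p, 0 <= q & q <= B]) g1.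
  have h : laurent (fun p q => (0 <= p) && (0 <= q)) g1.
    apply: laurentB => //; apply: laurentM LP Lh1p; lia.
  have h' : laurent (fun p q => (0 <= p) && (q <= B)) g1.
    apply: laurent_ext g1e _; apply: laurentD => //; apply: laurentM LP Lh1n; lia.
  apply: laurent_sub (laurentI h h'); lia.
have Lg2 : laurent (fun p q => (p <= delta%:Z * q + A)) g2.
  by apply: laurentB; [apply: laurent_sub L10|apply: laurentM LP Lh2p]; nia.
(* [P k] is the discrepancy between [g1] and [g2]. The exponents of [k] satisfy q >= 0 by definition
   and q <= B - D2 < 0 by the cocycle relation. *)
pose k x y := h3 x y - h1p x y + h2p x y.
have k0 : teq k (fun _ _ => 0).
  have L1 : laurent (fun p q => 0 <= q) k.
    apply: laurentD; first apply: laurentB => //.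
      by apply: laurent_sub Lh1p; lia.
    by apply: laurent_sub Lh2p; lia.
  have L2 : laurent (fun p q => q <= B - D2) k.
    apply: (laurent_ext (f := fun x y => h4 x y + (h1n x y - h2n x y))).
      move=> x y x0 y0; rewrite /k.
      have := e12 x y x0 y0; rewrite eh1 // eh2 // => /eqP; rewrite subr_eq => /eqP ->.
      ring.
    apply: laurentD => //; apply: laurentB.
      by apply: laurent_sub Lh1n; lia.
    by apply: laurent_sub Lh2n; lia.
  apply: laurent_empty (laurentI L1 L2) => p q; lia.
have g12 : teq g1 g2.
  move=> x y x0 y0; apply/eqP; rewrite -subr_eq0; apply/eqP.
  rewrite -(mulr0 (P x y)) -(k0 x y x0 y0) /k /g1 /g2.
  rewrite mulrDr mulrBr -e3 //; ring.
exists g1, h1p, (fun x y => - h1n x y), h2p; split.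
- apply: laurent_sub (laurentI Lg1 (laurent_ext g12 Lg2)); lia.
- split; first by [].
  by move=> x y x0 y0; rewrite /g1; ring.
- split; first by apply: laurentN; apply: laurent_sub Lh1n; lia.
  by move=> x y x0 y0; rewrite g1e //; ring.
- split; first by apply: laurent_sub Lh2p; lia.
  by move=> x y x0 y0; rewrite g12 // /g2; ring.
Qed.

(** * Twisted vector fields *)

Section HirzebruchFields.
Variables (K : numClosedFieldType) (delta : nat).
Implicit Types (c : chart) (s : chart -> 'cV[{mpoly K[2]}]_2).
Implicit Types (Phi : chart -> 'M[{mpoly K[2]}]_2).

Definition vfx s c : {mpoly K[2]} := s c ord0 ord0.
Definition vfy s c : {mpoly K[2]} := s c ord_max ord0.

Definition lbX_exp (d1 d2 : int) (j : bool) : int :=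
  if j then d1 + delta%:Z * d2 else d1.

Lemma lbXE d1 d2 j (x : K) : lbX delta d1 d2 j x = x ^ lbX_exp d1 d2 j.
Proof. by case: j. Qed.

Lemma mx2M (a b c d a' b' c' d' : K) : mx2 a b c d *m mx2 a' b' c' d' =
  mx2 (a * a' + b * c') (a * b' + b * d') (c * a' + d * c') (c * b' + d * d')
  :> 'M[K]_2.
Proof.
apply/matrixP => r k; rewrite !mxE big_ord_recl big_ord1 !mxE /=.
by case: (ord2P r) => ->; case: (ord2P k) => ->.
Qed.

Lemma mx2P (M N : 'M[K]_2) : M ord0 ord0 = N ord0 ord0 ->
  M ord0 ord_max = N ord0 ord_max -> M ord_max ord0 = N ord_max ord0 ->
  M ord_max ord_max = N ord_max ord_max -> M = N.
Proof.
move=> h1 h2 h3 h4; apply/matrixP => r k.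
by case: (ord2P r) => ->; case: (ord2P k) => ->.
Qed.

(** The Jacobian is lower triangular: [vfx] transforms by itself, [vfy] only modulo [vfx]. *)
Lemma twisted_vf_x d1 d2 s i j x y : is_twisted_vf delta d1 d2 s -> x != 0 ->
  eval2 x^-1 (x ^ twist delta j * y) (vfx s (~~ i, j)) =
    - x ^ (- 2%:Z - lbX_exp d1 d2 j) * eval2 x y (vfx s (i, j)) /\
  eval2 x^-1 (x ^ twist delta j * y) (vfy s (~~ i, j)) =
    x ^ (twist delta j - lbX_exp d1 d2 j) * eval2 x y (vfy s (i, j)) +
    (twist delta j)%:~R * x ^ (twist delta j - 1 - lbX_exp d1 d2 j) * y *
      eval2 x y (vfx s (i, j)).
Proof.
move=> [sx _] x0; have /matrixP e := sx i j x y x0.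
have e0 := e ord0 ord0; have e1 := e ord_max ord0; rewrite !lbXE in e0 e1.
set D := lbX_exp d1 d2 j in e0 e1 *.
have xD0 : x ^ D != 0 by rewrite expfz_neq0.
rewrite !mxE !big_ord_recl !big_ord0 !mxE /= in e0 e1.
rewrite -/(vfx s (i, j)) -/(vfx s (~~ i, j)) in e0 e1.
have l1 : lift ord0 ord0 = ord_max :> 'I_2 by apply: val_inj.
rewrite l1 -/(vfy s (i, j)) -/(vfy s (~~ i, j)) in e0 e1.
split; apply: (mulfI xD0).
  rewrite -e0 expfzDr // -(invr_expz x D).
  by move: (x ^ _) (x ^ D) xD0 => u v v0; field.
rewrite -e1 !expfzDr // -(invr_expz x D).
by move: (x ^ twist _ _) (x ^ (- 1)) (x ^ D) xD0 => u w v v0; field.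
Qed.

Lemma twisted_vf_y d1 d2 s i j x y : is_twisted_vf delta d1 d2 s -> y != 0 ->
  eval2 x y^-1 (vfx s (i, ~~ j)) = y ^ (- d2) * eval2 x y (vfx s (i, j)) /\
  eval2 x y^-1 (vfy s (i, ~~ j)) = - y ^ (- 2%:Z - d2) * eval2 x y (vfy s (i, j)).
Proof.
move=> [_ sy] y0; have /matrixP e := sy i j x y y0.
have e0 := e ord0 ord0; have e1 := e ord_max ord0; rewrite /lbY in e0 e1.
have yd0 : y ^ d2 != 0 by rewrite expfz_neq0.
rewrite !mxE !big_ord_recl !big_ord0 !mxE /= in e0 e1.
rewrite -/(vfx s (i, j)) -/(vfx s (i, ~~ j)) in e0 e1.
have l1 : lift ord0 ord0 = ord_max :> 'I_2 by apply: val_inj.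
rewrite l1 -/(vfy s (i, j)) -/(vfy s (i, ~~ j)) in e0 e1.
split; apply: (mulfI yd0).
  rewrite -e0 -(invr_expz y d2).
  by move: (y ^ d2) yd0 => v v0; field.
rewrite -e1 expfzDr // -(invr_expz y d2).
by move: (y ^ (- 2%:Z)) (y ^ d2) yd0 => u v v0; field.
Qed.

Lemma expzN_mul (x y : K) (n : int) :
  x ^ (- n) * y^-1 = (x ^ n * y)^-1.
Proof. by rewrite invfM invr_expz. Qed.

Lemma laurent_eval2_x0 (f : {mpoly K[2]}) :
  laurent (fun p q => (p <= delta%:Z * q) && (0 <= q))
    (fun x y => eval2 x^-1 (x ^ delta%:Z * y) f).
Proof.
apply: (laurent_comp (u := fun x _ => x^-1) (v := fun x y => x ^ delta%:Z * y)
  (a := -1) (c := delta%:Z) (d := 1)) (laurent_eval2 f).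
- by move=> p q /andP[p0 q0]; apply/andP; split; nia.
- by move=> x y _ _; rewrite exprN1.
- by move=> x y _ _; rewrite expr1z.
Qed.

Lemma laurent_eval2_0y (f : {mpoly K[2]}) :
  laurent (fun p q => (0 <= p) && (q <= 0)) (fun x y => eval2 x y^-1 f).
Proof.
apply: (laurent_comp (u := fun x _ => x) (v := fun x y => y^-1)
  (a := 1) (c := 0) (d := -1)) (laurent_eval2 f).
- by move=> p q /andP[p0 q0]; apply/andP; split; lia.
- by move=> x y _ _; rewrite expr1z.
- by move=> x y _ _; rewrite expr0z mul1r exprN1.
Qed.

Lemma laurent_eval2_xy (f : {mpoly K[2]}) :
  laurent (fun p q => (p <= delta%:Z * q) && (q <= 0))
    (fun x y => eval2 x^-1 (x ^ (- delta%:Z) * y^-1) f).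
Proof.
apply: (laurent_comp (u := fun x _ => x^-1)
  (v := fun x y => x ^ (- delta%:Z) * y^-1) (a := -1) (c := - delta%:Z) (d := -1)) (laurent_eval2 f).
- by move=> p q /andP[p0 q0]; apply/andP; split; nia.
- by move=> x y _ _; rewrite exprN1.
- by move=> x y _ _; rewrite exprN1.
Qed.

(** The change of coordinates permutes the points of the torus, and these determine a polynomial. *)
Lemma eval2_x_inj i j (f g : chart -> {mpoly K[2]}) :
  (forall x y, x != 0 -> eval2 x^-1 (x ^ twist delta j * y) (f (~~ i, j)) =
                         eval2 x^-1 (x ^ twist delta j * y) (g (~~ i, j))) ->
  f (~~ i, j) = g (~~ i, j).
Proof.
move=> h; apply: eval2_torus_inj => x y x0 y0.
have xi0 : x^-1 != 0 by rewrite invr_eq0.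
have := h x^-1 (x ^ twist delta j * y) xi0.
by rewrite invrK mulrA exprz_inv -expfzDr // addNr expr0z mul1r.
Qed.

Lemma eval2_y_inj i j (f g : chart -> {mpoly K[2]}) :
  (forall x y, y != 0 -> eval2 x y^-1 (f (i, ~~ j)) = eval2 x y^-1 (g (i, ~~ j))) ->
  f (i, ~~ j) = g (i, ~~ j).
Proof.
move=> h; apply: eval2_torus_inj => x y x0 y0.
have yi0 : y^-1 != 0 by rewrite invr_eq0.
by have := h x y^-1 yi0; rewrite invrK.
Qed.

Lemma vfP s s' c : vfx s c = vfx s' c -> vfy s c = vfy s' c -> s c = s' c.
Proof.
move=> h0 h1; apply/matrixP => r k; rewrite (ord1 k).
by case: (ord2P r) => ->.
Qed.

Lemma chart_ind (T : chart -> Prop) :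
  (forall i j, T (i, j) -> T (~~ i, j)) -> (forall i j, T (i, j) -> T (i, ~~ j)) ->
  T (false, false) -> forall c, T c.
Proof.
move=> hx hy h00 [i j]; have h0 k : T (k, false).
  by case: k => //; apply: (hx false).
by case: j => //; apply: (hy _ false).
Qed.

Lemma twisted_vf_eq d1 d2 s s' :
  is_twisted_vf delta d1 d2 s -> is_twisted_vf delta d1 d2 s' ->
  s (false, false) = s' (false, false) -> forall c, s c = s' c.
Proof.
move=> hs hs'; apply: chart_ind => i j e.
  apply: vfP; apply: eval2_x_inj => x y x0.
    by rewrite (twisted_vf_x i j y hs x0).1 (twisted_vf_x i j y hs' x0).1 /vfx e.
  by rewrite (twisted_vf_x i j y hs x0).2 (twisted_vf_x i j y hs' x0).2 /vfx /vfy e.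
apply: vfP; apply: eval2_y_inj => x y y0.
  by rewrite (twisted_vf_y i j x hs y0).1 (twisted_vf_y i j x hs' y0).1 /vfx e.
by rewrite (twisted_vf_y i j x hs y0).2 (twisted_vf_y i j x hs' y0).2 /vfy e.
Qed.

Lemma eval2_mx_inj (m n : nat) (M N : 'M[{mpoly K[2]}]_(m, n)) :
  (forall x y, x != 0 -> y != 0 -> map_mx (eval2 x y) M = map_mx (eval2 x y) N) ->
  M = N.
Proof.
move=> h; apply/matrixP => r k; apply: eval2_torus_inj => x y x0 y0.
by have /matrixP/(_ r k) := h x y x0 y0; rewrite !mxE.
Qed.

Lemma jacX_unit j (x y : K) : x != 0 -> exists M, jacX delta j x y *m M = 1%:M.
Proof.
move=> x0; rewrite /jacX; set t := twist delta j.
exists (mx2 (- x ^ 2%:Z) 0 (t%:~R * x * y) (x ^ (- t))).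
rewrite mx2M; apply: mx2P; rewrite !mxE /= ?mul0r ?mulr0 ?addr0 ?add0r //.
- by rewrite mulrNN -expfzDr.
- by rewrite expfzDr // -invr_expz; field.
- by rewrite -expfzDr // subrr.
Qed.

Lemma jacY_unit (y : K) : y != 0 -> exists M, jacY y *m M = 1%:M.
Proof.
move=> y0; rewrite /jacY; exists (mx2 1 0 0 (- y ^ 2%:Z)).
rewrite mx2M; apply: mx2P; rewrite !mxE /= ?mul0r ?mulr0 ?addr0 ?add0r ?mulr1 //.
by rewrite mulrNN -expfzDr.
Qed.

Lemma tangent_endo_eq Phi Psi :
  is_tangent_endo delta Phi -> is_tangent_endo delta Psi ->
  Phi (false, false) = Psi (false, false) -> forall c, Phi c = Psi c.
Proof.
move=> [Px Py] [Qx Qy]; apply: chart_ind => i j e.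
  apply: eval2_mx_inj => x y x0 y0.
  have xi0 : x^-1 != 0 by rewrite invr_eq0.
  have := Px i j _ (x ^ twist delta j * y) xi0; rewrite e Qx //.
  rewrite invrK mulrA exprz_inv -expfzDr // addNr expr0z mul1r.
  have [M JM] := jacX_unit j (x ^ twist delta j * y) xi0.
  by move=> /(congr1 (mulmx^~ M)); rewrite -!mulmxA !JM !mulmx1.
apply: eval2_mx_inj => x y x0 y0.
have yi0 : y^-1 != 0 by rewrite invr_eq0.
have := Py i j x _ yi0; rewrite e Qy // invrK.
have [M JM] := jacY_unit yi0.
by move=> /(congr1 (mulmx^~ M)); rewrite -!mulmxA !JM !mulmx1.
Qed.

Lemma endo_act_twisted_vf d1 d2 Phi s :
  is_tangent_endo delta Phi -> is_twisted_vf delta d1 d2 s ->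
  is_twisted_vf delta d1 d2 (endo_act Phi s).
Proof.
move=> [Px Py] [sx sy]; split=> i j x y z0; rewrite /endo_act !map_mxM /=.
  by rewrite mulmxA Px // -mulmxA sx // -scalemxAr.
by rewrite mulmxA Py // -mulmxA sy // -scalemxAr.
Qed.
End HirzebruchFields.

(** * Gluing along the curve of vanishing of the first component *)

Section Overlaps.
Variables (K : numClosedFieldType) (delta : nat).
Implicit Types (s : chart -> 'cV[{mpoly K[2]}]_2).

(** Regularity survives inverting one variable, y if [b] and x otherwise: a power of it clears the
    denominators of [u] and [v], and is divided out at the end. *)
Lemma regular_laurent (b : bool) (P Q : {mpoly K[2]}) u v :
  let A p q := if b then 0 <= p else 0 <= q in
  regular_pair P Q -> laurent A u -> laurent A v ->
  teq (fun x y => u x y * eval2 x y Q) (fun x y => v x y * eval2 x y P) ->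
  exists2 w, laurent A w & teq u (fun x y => eval2 x y P * w x y).
Proof.
move=> A reg /laurent_bound[N1 uN] /laurent_bound[N2 vN] e.
pose N := (N1 + N2)%N; pose z (n : int) (x y : K) := if b then y ^ n else x ^ n.
have zM n m x y : x != 0 -> y != 0 -> z n x y * z m x y = z (n + m) x y.
  by rewrite /z; case: b {A uN vN z} => x0 y0; rewrite expfzDr.
have Lz n : laurent (fun p q =>
    if b then (p == 0) && (q == n) else (q == 0) && (p == n)) (z n).
  rewrite /z; case: b {A uN vN z zM};
    [apply: (laurent_ext (f := fun x y => 1 * x ^ 0 * y ^ n))|
    apply: (laurent_ext (f := fun x y => 1 * x ^ n * y ^ 0))].
  - by move=> x y _ _; rewrite expr0z !mul1r.
  - by apply: laurent_mon; rewrite !eqxx.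
  - by move=> x y _ _; rewrite expr0z mulr1 mul1r.
  - by apply: laurent_mon; rewrite !eqxx.
have [|U eU] := @laurent_poly _ (fun x y => z N x y * u x y).
  apply: (laurentM _ (Lz N) uN).
  by rewrite /A /nonneg_supp; case: b {A uN vN z zM Lz}; lia.
have [|V eV] := @laurent_poly _ (fun x y => z N x y * v x y).
  apply: (laurentM _ (Lz N) vN).
  by rewrite /A /nonneg_supp; case: b {A uN vN z zM Lz eU}; lia.
have [t _ eUt] : exists2 t, V = t * Q & U = t * P.
  apply: reg; apply: eval2_torus_inj => x y x0 y0.
  by rewrite !rmorphM /= -eU // -eV // -!mulrA e.
exists (fun x y => z (- N%:Z) x y * eval2 x y t).
  apply: (laurentM _ (Lz _) (laurent_eval2 t)).
  by rewrite /A /nonneg_supp; case: b {A uN vN z zM Lz eU eV}; lia.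
move=> x y x0 y0.
have zN : z (- N%:Z) x y * z N x y = 1.
  by rewrite zM // addNr /z; case: b {A uN vN z zM Lz eU eV}; rewrite expr0z.
rewrite -[LHS]mul1r -zN -mulrA eU // eUt rmorphM /=; ring.
Qed.

Lemma laurent_eval2_flip j (f : {mpoly K[2]}) : laurent (fun p q => 0 <= q)
  (fun x y => eval2 x^-1 (x ^ twist delta j * y) f).
Proof.
apply: (laurent_comp (u := fun x _ => x^-1) (v := fun x y => x ^ twist delta j * y)
  (a := -1) (c := twist delta j) (d := 1)) (laurent_eval2 f).
- by move=> p q /andP[p0 q0]; lia.
- by move=> x y _ _; rewrite exprN1.
- by move=> x y _ _; rewrite expr1z.
Qed.

(* If T = m P + n Q on a chart and T' = m' P' + n' Q' on the adjacent one, the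
   regularity of P, Q makes n and n' agree modulo P, up to the ratio of the
   transition functions of Q and T. *)
Lemma overlap_x d1 d2 s i j (T T' m n m' n' : {mpoly K[2]}) t k sg :
  is_twisted_vf delta d1 d2 s ->
  regular_pair (vfx s (i, j)) (vfy s (i, j)) ->
  T = m * vfx s (i, j) + n * vfy s (i, j) ->
  T' = m' * vfx s (~~ i, j) + n' * vfy s (~~ i, j) ->
  laurent (fun p q => 0 <= q) sg -> t != 0 ->
  teq (fun x y => eval2 x^-1 (x ^ twist delta j * y) T')
      (fun x y => t * x ^ k * eval2 x y T + sg x y * eval2 x y (vfx s (i, j))) ->
  exists2 w, laurent (fun p q => 0 <= q) w &
    teq (fun x y => eval2 x y n - t^-1 * x ^ (twist delta j - lbX_exp delta d1 d2 j - k) *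
           eval2 x^-1 (x ^ twist delta j * y) n')
        (fun x y => eval2 x y (vfx s (i, j)) * w x y).
Proof.
move=> hs reg eT eT' Lsg t0 tr.
set tw := twist delta j; set D := lbX_exp delta d1 d2 j.
pose f' (f : {mpoly K[2]}) x y := eval2 x^-1 (x ^ tw * y) f.
(* Inserting both expressions into the transition of [T] leaves a multiple of [vfy] equal to a
   multiple of [vfx], and [v] is the coefficient of the latter. *)
pose v x y := - eval2 x y m + t^-1 * x ^ (- k) * (- x ^ (- 2%:Z - D) * f' m' x y +
  tw%:~R * x ^ (tw - 1 - D) * y ^ 1 * f' n' x y - sg x y).
have Lq (f : K -> K -> K) : laurent (@nonneg_supp) f -> laurent (fun p q => 0 <= q) f.
  by apply: laurent_sub => p q /andP[].
have LM (f g : K -> K -> K) : 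
    laurent (fun p q => 0 <= q) f -> laurent (fun p q => 0 <= q) g ->
    laurent (fun p q => 0 <= q) (fun x y => f x y * g x y).
  by apply: laurentM => *; lia.
have L' f : laurent (fun p q => 0 <= q) (f' f) by apply: laurent_eval2_flip.
apply: (regular_laurent (b := false) (Q := vfy s (i, j)) (v := v)) => //=.
- apply: laurentB; first exact/Lq/laurent_eval2.
  by apply: (LM); [apply: (LM); [exact: laurent_cst|exact: laurent_monx]|exact: L'].
- apply: laurentD; first exact/laurentN/Lq/laurent_eval2.
  apply: (LM); first by apply: (LM); [exact: laurent_cst|exact: laurent_monx].
  apply: laurentB => //; apply: laurentD.
    by apply: (LM); [exact/laurentN/laurent_monx|exact: L'].
  apply: (LM); last exact: L'.
  apply: (LM); last exact: laurent_mony.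
  by apply: (LM); [exact: laurent_cst|exact: laurent_monx].
move=> x y x0 y0; have := tr x y x0 y0.
have [rx ry] := twisted_vf_x i j y hs x0.
rewrite eT eT' !rmorphD !rmorphM /= rx ry.
rewrite -/tw -/D /v /f' expr1z.
set P := eval2 x y (vfx _ _); set Q := eval2 x y (vfy _ _).
set M := eval2 x y m; set N := eval2 x y n.
set M' := eval2 _ _ m'; set N' := eval2 _ _ n'.
have -> : x ^ (tw - D - k) = x ^ (tw - D) / x ^ k by rewrite expfzDr // invr_expz.
rewrite -(invr_expz x k).
have xk0 : x ^ k != 0 by rewrite expfz_neq0.
move: (x ^ k) (x ^ (tw - D)) (x ^ (- 2%:Z - D)) (x ^ (tw - 1 - D)) (sg x y) xk0.
move=> X a b c S X0 e.
apply: (mulfI (x := t * X)); first by rewrite mulf_neq0.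
apply/eqP; rewrite -subr_eq0; apply/eqP.
transitivity ((t * X * (M * P + N * Q) + S * P) -
  (M' * (- b * P) + N' * (a * Q + tw%:~R * c * y * P))); first by field; rewrite t0 X0.
by rewrite e subrr.
Qed.

(** The counterpart of [overlap_x]; as [jacY] is diagonal, no multiple of [vfx] enters the
    transition of [T]. *)
Lemma overlap_y d1 d2 s i j (T T' m n m' n' : {mpoly K[2]}) t k :
  is_twisted_vf delta d1 d2 s ->
  regular_pair (vfx s (i, j)) (vfy s (i, j)) ->
  T = m * vfx s (i, j) + n * vfy s (i, j) ->
  T' = m' * vfx s (i, ~~ j) + n' * vfy s (i, ~~ j) ->
  t != 0 ->
  teq (fun x y => eval2 x y^-1 T') (fun x y => t * y ^ k * eval2 x y T) ->
  exists2 w, laurent (fun p q => 0 <= p) w &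
    teq (fun x y => eval2 x y n - - t^-1 * y ^ (- 2%:Z - d2 - k) * eval2 x y^-1 n')
        (fun x y => eval2 x y (vfx s (i, j)) * w x y).
Proof.
move=> hs reg eT eT' t0 tr.
pose v x y := - eval2 x y m + t^-1 * y ^ (- k) * (y ^ (- d2) * eval2 x y^-1 m').
have Lp (f : K -> K -> K) : laurent (@nonneg_supp) f -> laurent (fun p q => 0 <= p) f.
  by apply: laurent_sub => p q /andP[].
have LM (f g : K -> K -> K) : 
    laurent (fun p q => 0 <= p) f -> laurent (fun p q => 0 <= p) g ->
    laurent (fun p q => 0 <= p) (fun x y => f x y * g x y).
  by apply: laurentM => *; lia.
have L' f : laurent (fun p q => 0 <= p) (fun x y => @eval2 K x y^-1 f).
  by apply: laurent_sub (laurent_eval2_0y f) => p q /andP[].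
apply: (regular_laurent (b := true) (Q := vfy s (i, j)) (v := v)) => //=.
- apply: laurentB; first exact/Lp/laurent_eval2.
  by apply: (LM); [apply: (LM); [exact: laurent_cst|exact: laurent_mony]|exact: L'].
- apply: laurentD; first exact/laurentN/Lp/laurent_eval2.
  apply: (LM); first by apply: (LM); [exact: laurent_cst|exact: laurent_mony].
  by apply: (LM); [exact: laurent_mony|exact: L'].
move=> x y x0 y0; have := tr x y x0 y0.
have [rx ry] := twisted_vf_y i j x hs y0.
rewrite eT eT' !rmorphD !rmorphM /= rx ry.
rewrite /v.
set P := eval2 x y (vfx _ _); set Q := eval2 x y (vfy _ _).
set M := eval2 x y m; set N := eval2 x y n.
set M' := eval2 _ _ m'; set N' := eval2 _ _ n'.
have -> : y ^ (- 2%:Z - d2 - k) = y ^ (- 2%:Z - d2) / y ^ k.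
  by rewrite [LHS]expfzDr // invr_expz.
rewrite -(invr_expz y k).
have yk0 : y ^ k != 0 by rewrite expfz_neq0.
move: (y ^ k) (y ^ (- 2%:Z - d2)) (y ^ (- d2)) yk0 => X a b X0 e.
apply: (mulfI (x := t * X)); first by rewrite mulf_neq0.
apply/eqP; rewrite -subr_eq0; apply/eqP.
transitivity (t * X * (M * P + N * Q) -
  (M' * (b * P) + N' * (- a * Q))); first by field; rewrite t0 X0.
by rewrite e subrr.
Qed.
End Overlaps.

(** * Gluing data of the four charts in the coordinates of the chart (0,0) *)

Section Gluing.
Variables (K : numClosedFieldType) (delta : nat) (d1 d2 : int).
Variable s : chart -> 'cV[{mpoly K[2]}]_2.
Hypothesis hs : is_twisted_vf delta d1 d2 s.
Local Notation dd := (delta%:Z).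
Local Notation P00 x y := (eval2 x y (vfx s (false, false))).

(** The exponents of a section of O(2 + d1, d2): x^p y^q comes from X_0^(delta q + 2 + d1 - p) X_1^p
    Y_0^(d2 - q) Y_1^q. The 2 is the degree of the tangent sheaf of the base. *)
Lemma vfx_supp :
  laurent (fun p q => [&& 0 <= p, p <= dd * q + (2 + d1), 0 <= q & q <= d2])
    (fun x y => P00 x y).
Proof.
have h0 := laurent_eval2 (vfx s (false, false)).
have hy : laurent (fun p q => q <= d2) (fun x y => P00 x y).
  apply: (laurent_ext (f := fun x y => 1 * y ^ d2 * eval2 x y^-1 (vfx s (false, true)))).
    move=> x y x0 y0; rewrite (twisted_vf_y false false x hs y0).1 mul1r mulrA.
    by rewrite -expfzDr // subrr expr0z mul1r.
  apply: (laurent_scaley _ _ (laurent_eval2_0y _)); lia.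
have hx : laurent (fun p q => p <= dd * q + (2 + d1)) (fun x y => P00 x y).
  apply: (laurent_ext (f := fun x y => -1 * x ^ (2 + d1) *
      eval2 x^-1 (x ^ dd * y) (vfx s (true, false)))).
    move=> x y x0 y0; rewrite (twisted_vf_x false false y hs x0).1 mulrA mulN1r mulrNN.
    by rewrite -expfzDr // (_ : 2 + d1 + _ = 0) ?expr0z ?mul1r //=; lia.
  apply: (laurent_scalex _ _ (laurent_eval2_x0 _ _)); lia.
apply: laurent_sub (laurentI (laurentI h0 hy) hx) => p q.
by rewrite /nonneg_supp => /andP[/andP[/andP[-> ->] ->] ->].
Qed.

(** Modulo [vfx], the family [n] is a section of O(A, B), up to a factor [sg] in both kinds of
    transition functions. *)
Lemma chart_glue (A B : int) (sg : K) (n : chart -> {mpoly K[2]}) :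
  torus_nonzero (fun x y => P00 x y) ->
  (forall j, exists2 w, laurent (fun p q => 0 <= q) w &
    teq (fun x y => eval2 x y (n (false, j)) -
           sg * x ^ (if j then A + dd * B else A) *
           eval2 x^-1 (x ^ twist delta j * y) (n (true, j)))
        (fun x y => eval2 x y (vfx s (false, j)) * w x y)) ->
  (forall i, exists2 w, laurent (fun p q => 0 <= p) w &
    teq (fun x y => eval2 x y (n (i, false)) -
           sg * y ^ B * eval2 x y^-1 (n (i, true)))
        (fun x y => eval2 x y (vfx s (i, false)) * w x y)) ->
  B < d2 ->
  (forall m, laurent (fun p q => [&& 0 <= p, p <= dd * q + A - (2 + d1),
                                     B - d2 < q & q < 0]) m ->
     laurent (fun p q => (0 <= q) || (q <= B)) (fun x y => P00 x y * m x y) ->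
     teq m (fun _ _ => 0)) ->
  exists g k00 k01 k10,
  [/\ laurent (fun p q => [&& 0 <= p, p <= dd * q + A, 0 <= q & q <= B]) g,
      laurent (fun p q => (0 <= p) && (0 <= q)) k00 /\
        teq (fun x y => eval2 x y (n (false, false)))
            (fun x y => g x y + P00 x y * k00 x y),
      laurent (fun p q => (0 <= p) && (q <= B - d2)) k01 /\
        teq (fun x y => sg * y ^ B * eval2 x y^-1 (n (false, true)))
            (fun x y => g x y + P00 x y * k01 x y) &
      laurent (fun p q => (p <= dd * q + A - (2 + d1)) && (0 <= q)) k10 /\
        teq (fun x y => sg * x ^ A * eval2 x^-1 (x ^ dd * y) (n (true, false)))
            (fun x y => g x y + P00 x y * k10 x y)].
Proof.
move=> P0 hx hy Bd Hmid.
have [w1 Lw1 e1] := hy false; have [w2 Lw2 e2] := hy true.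
have [w3 Lw3 e3] := hx false; have [w4 Lw4 e4] := hx true.
(* From (1,1) to (0,0) two overlaps are crossed, hence the two factors [sg]. *)
pose b11 x y := sg * sg * x ^ (A + dd * B) * y ^ B *
  eval2 x^-1 (x ^ (- dd) * y^-1) (n (true, true)).
(* When [w2] and [w4] are moved, the factors - x^(-2 - d1) and y^(- d2) by which [vfx] changes join
   those of O(A, B). *)
apply: (laurent_glue (b11 := b11) (h1 := w1) (h3 := w3)
  (h2 := fun x y => - sg * x ^ (A - (2 + d1)) * w2 x^-1 (x ^ dd * y))
  (h4 := fun x y => sg * y ^ (B - d2) * w4 x y^-1)) => //.
- exact: vfx_supp.
- exact: laurent_eval2.
- by apply: (laurent_scaley _ _ (laurent_eval2_0y _)); lia.
- by apply: (laurent_scalex _ _ (laurent_eval2_x0 _ _)); lia.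
- by apply: (laurent_scale _ _ (laurent_eval2_xy _ _)); lia.
- apply: (laurent_scalex (A := fun p q => p <= dd * q)); first lia.
  apply: (laurent_comp (a := -1) (c := dd) (d := 1) _ _ _ Lw2) => [p q|x y _ _|x y _ _].
  + by lia.
  + by rewrite exprN1.
  + by rewrite expr1z.
- apply: (laurent_scaley (A := fun p q => q <= 0)); first lia.
  apply: (laurent_comp (a := 1) (c := 0) (d := -1) _ _ _ Lw4) => [p q|x y _ _|x y _ _].
  + by lia.
  + by rewrite expr1z.
  + by rewrite expr0z mul1r exprN1.
- move=> x y x0 y0; have xi0 : x^-1 != 0 by rewrite invr_eq0.
  have xy0 : x ^ dd * y != 0 by rewrite mulf_neq0 ?expfz_neq0.
  have := e2 _ _ xi0 xy0; rewrite (twisted_vf_x false false y hs x0).1.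
  rewrite -expzN_mul expfzMl => e.
  have E1 : x ^ (A + dd * B) = x ^ A * (x ^ dd) ^ B by rewrite expfzDr // exprz_exp.
  have E2 : x ^ (A - (2 + d1)) = x ^ A * x ^ (- 2%:Z - d1).
    by rewrite -expfzDr //; congr (_ ^ _); lia.
  rewrite /b11 E1 E2.
  transitivity (sg * x ^ A * (eval2 x^-1 (x ^ dd * y) (n (true, false)) -
    sg * ((x ^ dd) ^ B * y ^ B) * eval2 x^-1 (x ^ (- dd) * y^-1) (n (true, true)))).
    by ring.
  by rewrite e /=; ring.
- move=> x y x0 y0; have yi0 : y^-1 != 0 by rewrite invr_eq0.
  have := e4 _ _ x0 yi0; rewrite (twisted_vf_y false false x hs y0).1 => e.
  have E2 : y ^ (B - d2) = y ^ B * y ^ (- d2) by rewrite expfzDr.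
  rewrite /b11 E2.
  transitivity (sg * y ^ B * (eval2 x y^-1 (n (false, true)) -
    sg * x ^ (A + dd * B) * eval2 x^-1 (x ^ (- dd) * y^-1) (n (true, true)))).
    by ring.
  by rewrite e; ring.
Qed.
End Gluing.

(** * Comparing the components of two twisted vector fields *)

Section Comparison.
Variables (K : numClosedFieldType) (delta : nat) (d1 d2 : int).
Variable s : chart -> 'cV[{mpoly K[2]}]_2.
Hypothesis hs : is_twisted_vf delta d1 d2 s.
Hypothesis reg : forall c, regular_pair (vfx s c) (vfy s c).
Hypothesis P0 : vfx s (false, false) != 0.
Local Notation dd := (delta%:Z).
Local Notation c00 := (false, false).

(* When delta = 1 and d1 = 0, the line y = 0 of the first chart lies on the
   exceptional curve: if the first component vanished on it, the second one,
   a section there of a sheaf of degree -1, would vanish as well. *)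
Lemma vfx_exceptional : delta = 1%N -> d1 = 0 ->
  ~ laurent (fun p q => (0 <= p) && (1 <= q)) (fun x y => eval2 x y (vfx s c00)).
Proof.
move=> de d10 LP.
have divy f : laurent (fun p q => (0 <= p) && (1 <= q)) (fun x y => eval2 x y f) ->
    exists g, f = coord_y K * g.
  move=> Lf; have [|g gE] := @laurent_poly K (fun x y => 1 * y ^ (-1) * eval2 x y f).
    by apply: (laurent_scaley _ _ Lf); rewrite /nonneg_supp; lia.
  exists g; apply: eval2_torus_inj => x y x0 y0.
  by rewrite rmorphM /= -gE // eval2X /= exprN1; field.
have [R PR] := divy _ LP.
have [q1 [q2 [Lq1 Lq2 eq12]]] :=
  laurent_split (fun p q => q == 0) (laurent_eval2 (vfy s c00)).
(* [q1] is the restriction of [vfy] to y = 0. Times x, it has exponents p >= 1 by this chart and p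
   <= 0 by the neighbouring one. *)
have xq1 : teq (fun x y => 1 * x ^ 1 * q1 x y) (fun _ _ => 0).
  pose C (p q : int) := (1 <= q) || (p <= 0).
  have L1 : laurent (fun p q => (q == 0) && (1 <= p)) (fun x y => 1 * x ^ 1 * q1 x y).
    by apply: (laurent_scalex _ _ Lq1); rewrite /nonneg_supp; lia.
  have L2 : laurent C (fun x y => 1 * x ^ 1 * q1 x y).
    apply: (laurent_ext (f := fun x y =>
        eval2 x^-1 (x ^ dd * y) (vfy s (true, false)) -
        1 * y ^ 1 * eval2 x y (vfx s c00) - 1 * x ^ 1 * q2 x y)).
      move=> x y x0 y0; rewrite (twisted_vf_x false false y hs x0).2 /= eq12 //.
      by rewrite de d10 !subr0 subrr expr0z !expr1z; ring. 
    apply: laurentB; first apply: laurentB.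
    - by apply: laurent_sub (laurent_eval2_x0 _ _); rewrite /C; lia.
    - by apply: (laurent_scaley _ _ LP); rewrite /C; lia.
    - by apply: (laurent_scalex _ _ Lq2); rewrite /C /nonneg_supp; lia.
  by apply: laurent_empty (laurentI L1 L2); rewrite /C; lia.
have LQ : laurent (fun p q => (0 <= p) && (1 <= q)) (fun x y => eval2 x y (vfy s c00)).
  apply: (laurent_ext (f := q2)).
    move=> x y x0 y0; rewrite eq12 //; have := xq1 x y x0 y0.
    by rewrite mul1r expr1z => /eqP; rewrite mulf_eq0 (negPf x0) => /eqP ->; rewrite add0r.
  by apply: laurent_sub Lq2; rewrite /nonneg_supp; lia.
have [S QS] := divy _ LQ.
(* With both components divisible by y, regularity makes [R] a multiple of y [R]; the cofactor 1 - t
   y is nonzero at the origin, so [R = 0]. *)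
have [|t St Rt] := reg (c := c00) (u := S) (v := R); first by rewrite PR QS; ring.
have R0 : R = 0.
  have : R * (1 - t * coord_y K) = 0 by rewrite mulrBr mulr1 {1}Rt PR; ring.
  move/eqP; rewrite mulf_eq0 => /orP[/eqP //|/eqP/(congr1 (eval2 0 0))].
  rewrite rmorph0 rmorphB rmorphM rmorph1 /= eval2X /= mulr0 subr0 => /eqP.
  by rewrite oner_eq0.
by move/eqP: P0; apply; rewrite PR R0 mulr0.
Qed.

Hypothesis hd2 : 1 <= d2.
Hypothesis hd1 : 1 <= d1 \/ (delta = 1%N /\ d1 = 0).

Variable s' : chart -> 'cV[{mpoly K[2]}]_2.
Hypothesis hs' : is_twisted_vf delta d1 d2 s'.

(* The coefficient of vfy in an expression of vfx s' is, on the curve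
   vfx s = 0, a section of O(2 + delta, -2); it vanishes because
   H^1(O(delta - d1, - 2 - d2)) does, or does after multiplication by vfx s. *)
Lemma vfx_proportional :
  (forall c, exists m n, vfx s' c = m * vfx s c + n * vfy s c) ->
  exists a : K, vfx s' c00 = a%:MP * vfx s c00.
Proof.
move=> hT.
have [m hm] := choice hT; have {hT hm} [n hT] := choice hm.
have P0' := eval2_torus_nonzero P0.
(* The sign -1 comes from the derivatives of 1/x and 1/y. *)
have [||||g [k00 [k01 [k10 [Lg [Lk00 e00] [Lk01 e01] [Lk10 e10]]]]]] :=
  @chart_glue K delta d1 d2 s hs (2 + dd) (- 2%:Z) (-1) n P0'.
- move=> j; pose D := lbX_exp delta d1 d2 j.
  have [|||w Lw ew] := @overlap_x K delta d1 d2 s false j _ _ _ _ _ _ (-1)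
    (- 2%:Z - D) (fun _ _ => 0) hs (@reg _) (hT (false, j)) (hT (true, j)).
  + exact: laurent0.
  + by rewrite oppr_eq0 oner_eq0.
  + move=> x y x0 y0; rewrite (twisted_vf_x false j y hs' x0).1 -/D.
    by rewrite mul0r addr0 mulN1r.
  exists w => //; move=> x y x0 y0; rewrite -ew //; congr (_ - _ * x ^ _ * _).
    by rewrite invrN invr1.
  by rewrite /D /twist /lbX_exp; case: j {ew D}; lia.
- move=> i; have [||w Lw ew] := @overlap_y K delta d1 d2 s i false _ _ _ _ _ _ 1
    (- d2) hs (@reg _) (hT (i, false)) (hT (i, true)).
  + by rewrite oner_eq0.
  + by move=> x y x0 y0; rewrite (twisted_vf_y i false x hs' y0).1 mul1r.
  exists w => //; move=> x y x0 y0; rewrite -ew // invr1.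
  by congr (_ - _ * y ^ _ * _); lia.
- by lia.
(* The exponents satisfy 0 <= p <= delta (q + 1) - d1 and q <= -1: there are none if d1 >= 1, and
   only that of y^(-1) if delta = 1 and d1 = 0. *)
- move=> f Lf LPf; case: hd1 => [d11|[de d10]].
    by apply: laurent_empty Lf => p q; nia.
  have [a fa] : exists a, teq f (fun _ y => a * y ^ (-1)).
    have [|a fa] := @laurent_const K (fun x y => 1 * y ^ 1 * f x y).
      by apply: (laurent_scaley _ _ Lf); rewrite de d10; lia.
    exists a => x y x0 y0; rewrite -(fa x y x0 y0) mul1r expr1z exprN1; field => //.
  have [a0|a0] := eqVneq a 0; first by move=> x y x0 y0; rewrite fa // a0 mul0r.
  case: (vfx_exceptional de d10).
  (* [vfx s] times y^(-1) has no exponent q = -1, so [vfx s] has none with q = 0: it would vanish on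
     the exceptional curve. *)
  have L : laurent (fun p q => (1 <= q) || (q <= -1)) (fun x y => eval2 x y (vfx s c00)).
    apply: (laurent_ext (f := fun x y => a^-1 * y ^ 1 * (eval2 x y (vfx s c00) * f x y))).
      by move=> x y x0 y0; rewrite fa // exprN1 expr1z; field; rewrite a0 y0.
    by apply: (laurent_scaley _ _ LPf); lia.
  by apply: laurent_sub (laurentI L (laurent_eval2 _)); rewrite /nonneg_supp; lia.
have g0 : teq g (fun _ _ => 0) by apply: laurent_empty Lg; lia.
(* [tau] is the quotient of [vfx s'] by [vfx s], and [t01], [t10] are its expressions through the
   neighbouring charts. Together the three bounds leave the exponent (0, 0) alone. *)
pose tau x y := eval2 x y (m c00) + k00 x y * eval2 x y (vfy s c00).
have tauE : teq (fun x y => eval2 x y (vfx s' c00))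
    (fun x y => eval2 x y (vfx s c00) * tau x y).
  move=> x y x0 y0; rewrite hT rmorphD !rmorphM /= e00 // g0 // /tau; ring.
have Ltau : laurent (@nonneg_supp) tau.
  apply: laurentD; first exact: laurent_eval2.
  by apply: (laurentM _ Lk00 (laurent_eval2 _)); rewrite /nonneg_supp; lia.
pose t01 x y := eval2 x y^-1 (m (false, true)) -
  1 * y ^ (2 + d2) * (k01 x y * eval2 x y^-1 (vfy s (false, true))).
have Lt01 : laurent (fun p q => q <= 0) t01.
  apply: laurentB; first by apply: laurent_sub (laurent_eval2_0y _); lia.
  apply: (laurent_scaley _ (A := fun p q => q <= - 2%:Z - d2)); first lia.
  by apply: (laurentM _ Lk01 (laurent_eval2_0y _)); lia.
have e_t01 : teq tau t01.
  apply: (laurent_eq_cancel P0 Ltau Lt01) => x y x0 y0.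
  have /= h1 := (twisted_vf_y false false x hs' y0).1.
  have /= h2 := (twisted_vf_y false false x hs y0).1.
  have /= h3 := e01 x y x0 y0.
  rewrite g0 // add0r mulN1r -invr_expz in h3.
  rewrite hT rmorphD !rmorphM /= h2 tauE // -invr_expz in h1.
  have Z0 : y ^ 2%:Z != 0 by rewrite expfz_neq0.
  have Y0 : y ^ d2 != 0 by rewrite expfz_neq0.
  rewrite /t01 expfzDr //; move: (y ^ 2%:Z) (y ^ d2) Z0 Y0 h1 h3 => Z Y Z0 Y0 h1 h3.
  apply: (mulfI (x := Y^-1)); first by rewrite invr_eq0.
  rewrite -h1.
  have -> : eval2 x y^-1 (n (false, true)) =
      - Z * (eval2 x y (vfx s c00) * k01 x y).
    by rewrite -h3; field.
  by field; rewrite ?Y0.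
pose t10 x y := eval2 x^-1 (x ^ dd * y) (m (true, false)) +
  1 * x ^ (d1 - dd) * (k10 x y * eval2 x^-1 (x ^ dd * y) (vfy s (true, false))).
have Lt10 : laurent (fun p q => p <= dd * q) t10.
  apply: laurentD; first by apply: laurent_sub (laurent_eval2_x0 _ _); lia.
  apply: (laurent_scalex _ (A := fun p q => p <= dd * q + dd - d1)); first lia.
  by apply: (laurentM _ Lk10 (laurent_eval2_x0 _ _)); nia.
have e_t10 : teq tau t10.
  apply: (laurent_eq_cancel P0 Ltau Lt10) => x y x0 y0.
  have /= h1 := (twisted_vf_x false false y hs' x0).1.
  have /= h2 := (twisted_vf_x false false y hs x0).1.
  have /= h3 := e10 x y x0 y0.
  rewrite g0 // add0r in h3.
  rewrite hT rmorphD !rmorphM /= h2 tauE // in h1.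
  have E1 : x ^ (2 + dd) = x ^ 2%:Z * x ^ dd by rewrite expfzDr.
  have E2 : x ^ (- 2%:Z - d1) = (x ^ 2%:Z * x ^ d1)^-1.
    by rewrite -expfzDr // invr_expz; congr (_ ^ _); lia.
  have E3 : x ^ (d1 - dd) = x ^ d1 / x ^ dd by rewrite expfzDr // invr_expz.
  rewrite E1 in h3; rewrite E2 in h1; rewrite /t10 E3.
  have Z0 : x ^ 2%:Z != 0 by rewrite expfz_neq0.
  have Y0 : x ^ d1 != 0 by rewrite expfz_neq0.
  have X0 : x ^ dd != 0 by rewrite expfz_neq0.
  move: (eval2 x^-1 (x ^ dd * y) (m _)) (eval2 x^-1 (x ^ dd * y) (n _)) h1 h3 => M N.
  move: (eval2 x^-1 (x ^ dd * y) _) => Q.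
  move: (x ^ 2%:Z) (x ^ d1) (x ^ dd) Z0 Y0 X0 => Z Y X Z0 Y0 X0 h1 h3.
  apply: (mulfI (x := - (Z * Y)^-1)); first by rewrite oppr_eq0 invr_eq0 mulf_neq0.
  rewrite -h1; have -> : N = - (Z * X)^-1 * (eval2 x y (vfx s c00) * k10 x y).
    by rewrite -h3; field; rewrite Z0 X0.
  by field; rewrite ?Y0 ?X0 ?Z0.
have [|a tau_a] := @laurent_const K tau.
  apply: laurent_sub (laurentI Ltau
    (laurentI (laurent_ext e_t01 Lt01) (laurent_ext e_t10 Lt10))).
  by rewrite /nonneg_supp => p q; nia.
exists a; apply: eval2_torus_inj => x y x0 y0.
by rewrite rmorphM /= eval2C tauE // tau_a // mulrC.
Qed.

Lemma vfx_scale (a : K) : vfx s' c00 = a%:MP * vfx s c00 ->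
  forall c, vfx s' c = a%:MP * vfx s c.
Proof.
move=> e00; apply: chart_ind => // i j e.
  apply: (@eval2_x_inj _ delta i j (vfx s') (fun c => a%:MP * vfx s c)) => x y x0.
  rewrite rmorphM /= eval2C (twisted_vf_x i j y hs' x0).1 (twisted_vf_x i j y hs x0).1.
  by rewrite e rmorphM /= eval2C; ring.
apply: (@eval2_y_inj _ i j (vfx s') (fun c => a%:MP * vfx s c)) => x y y0.
rewrite rmorphM /= eval2C (twisted_vf_y i j x hs' y0).1 (twisted_vf_y i j x hs y0).1.
by rewrite e rmorphM /= eval2C; ring.
Qed.

(* On the curve vfx s = 0, the coefficient of vfy is a regular function, hence
   a constant e because H^1(O(- 2 - d1, - d2)) = 0. *)
Lemma vfy_combination (a : K) :
  vfx s' c00 = a%:MP * vfx s c00 ->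
  (forall c, exists m n, vfy s' c = m * vfx s c + n * vfy s c) ->
  exists (e : K) (gam : {mpoly K[2]}),
  [/\ vfy s' c00 = gam * vfx s c00 + e%:MP * vfy s c00,
      laurent (fun p q => q <= 2) (fun x y => eval2 x y gam) &
      laurent (fun p q => p <= dd * q - 2 - dd)
        (fun x y => eval2 x y gam + delta%:R * (a - e) * x ^ (-1) * y ^ 1)].
Proof.
move=> ea hT.
have hP := vfx_scale ea.
have [m hm] := choice hT; have {hT hm} [n hT] := choice hm.
have P0' := eval2_torus_nonzero P0.
have [||||g [k00 [k01 [k10 [Lg [Lk00 e00] [Lk01 e01] [Lk10 e10]]]]]] :=
  @chart_glue K delta d1 d2 s hs 0 0 1 n P0'.
- move=> j; pose D := lbX_exp delta d1 d2 j; pose tw := twist delta j.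
  (* Because [vfx s'] is [a] times [vfx s], the off-diagonal Jacobian entry only adds a multiple of
     [vfx s], as [overlap_x] allows. *)
  have [|||w Lw ew] := @overlap_x K delta d1 d2 s false j _ _ _ _ _ _ 1
    (tw - D) (fun x y => a * tw%:~R * x ^ (tw - 1 - D) * y ^ 1) hs (@reg _)
    (hT (false, j)) (hT (true, j)).
  + exact: laurent_mon.
  + by rewrite oner_eq0.
  + move=> x y x0 y0; rewrite (twisted_vf_x false j y hs' x0).2 -/D -/tw hP.
    by rewrite rmorphM /= eval2C expr1z; ring.
  exists w => //; move=> x y x0 y0; rewrite -ew // invr1; congr (_ - _ * x ^ _ * _).
  by rewrite -/D -/tw subrr mulr0 addr0; case: j {ew D tw}.
- move=> i; have [||w Lw ew] := @overlap_y K delta d1 d2 s i false _ _ _ _ _ _ (-1)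
    (- 2%:Z - d2) hs (@reg _) (hT (i, false)) (hT (i, true)).
  + by rewrite oppr_eq0 oner_eq0.
  + by move=> x y x0 y0; rewrite (twisted_vf_y i false x hs' y0).2 mulN1r.
  exists w => //; move=> x y x0 y0; rewrite -ew // invrN invr1 opprK.
  by rewrite subrr.
- by lia.
- move=> f Lf _; apply: laurent_empty Lf => p q.
  by case: hd1 => [?|[? ?]]; nia.
have [|e ge] := @laurent_const K g.
  by apply: laurent_sub Lg => p q; nia.
(* [gam] is the quotient of [vfy s' - e vfy s] by [vfx s]. *)
have [|gam gamE] := @laurent_poly _ (fun x y =>
    eval2 x y (m c00) + k00 x y * eval2 x y (vfy s c00)).
  apply: laurentD; first exact: laurent_eval2.
  by apply: (laurentM _ Lk00 (laurent_eval2 _)); rewrite /nonneg_supp; lia.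
have eQ : vfy s' c00 = gam * vfx s c00 + e%:MP * vfy s c00.
  apply: eval2_torus_inj => x y x0 y0.
  by rewrite hT !rmorphD !rmorphM /= eval2C -gamE // e00 // ge //; ring.
have Lgam := laurent_eval2 gam.
exists e, gam; split=> //.
  (* [gam] seen from the chart (0,1); the bound 2 comes from the factor - y^2 of the vertical
     direction. *)
  pose t01 x y := -1 * y ^ 2%:Z * eval2 x y^-1 (m (false, true)) -
    1 * y ^ (2 + d2) * (k01 x y * eval2 x y^-1 (vfy s (false, true))).
  have Lt01 : laurent (fun p q => q <= 2) t01.
    apply: laurentB.
      by apply: (laurent_scaley _ _ (laurent_eval2_0y _)); lia.
    apply: (laurent_scaley _ (A := fun p q => q <= - d2)); first lia.
    by apply: (laurentM _ Lk01 (laurent_eval2_0y _)); lia.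
  apply: (laurent_ext _ Lt01).
  apply: (laurent_eq_cancel P0 Lgam Lt01) => x y x0 y0.
  have /= h1 := (twisted_vf_y false false x hs' y0).2.
  have /= h2 := (twisted_vf_y false false x hs y0).1.
  have /= h4 := (twisted_vf_y false false x hs y0).2.
  have /= h3 := e01 x y x0 y0.
  rewrite ge // expr0z !mul1r in h3.
  rewrite hT rmorphD !rmorphM /= h2 h3 mulrDl {1}h4 eQ rmorphD !rmorphM /= eval2C in h1.
  have E2 : y ^ (- 2%:Z - d2) = (y ^ 2%:Z * y ^ d2)^-1.
    by rewrite -expfzDr // invr_expz; congr (_ ^ _); lia.
  rewrite E2 -invr_expz in h1.
  have Z0 : y ^ 2%:Z != 0 by rewrite expfz_neq0.
  have Y0 : y ^ d2 != 0 by rewrite expfz_neq0.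
  rewrite /t01 expfzDr //; move: (y ^ 2%:Z) (y ^ d2) Z0 Y0 h1 => Z Y Z0 Y0 h1.
  apply: (mulfI (x := - (Z * Y)^-1)); first by rewrite oppr_eq0 invr_eq0 mulf_neq0.
  apply: (addIr (- (Z * Y)^-1 * (e * eval2 x y (vfy s c00)))).
  rewrite -mulrDr [X in _ * (X + _) = _]mulrC -h1.
  by field; rewrite ?Y0 ?Z0.
(* Seen from the chart (1,0), the off-diagonal Jacobian entry contributes with coefficient [a]
   through [vfx s'] and [e] through [vfy s], whence the extra term delta (a - e) y / x. *)
pose t10 x y := -1 * x ^ (- 2%:Z - dd) * eval2 x^-1 (x ^ dd * y) (m (true, false)) +
  1 * x ^ (d1 - dd) * (k10 x y * eval2 x^-1 (x ^ dd * y) (vfy s (true, false))).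
have Lt10 : laurent (fun p q => p <= dd * q - 2 - dd) t10.
  apply: laurentD; first by apply: (laurent_scalex _ _ (laurent_eval2_x0 _ _)); lia.
  apply: (laurent_scalex _ (A := fun p q => p <= dd * q - 2 - d1)); first lia.
  by apply: (laurentM _ Lk10 (laurent_eval2_x0 _ _)); nia.
apply: (laurent_ext _ Lt10).
apply: (laurent_eq_cancel (A := fun _ _ => true) P0 _ Lt10) => [|x y x0 y0].
  apply: laurentD; first by apply: laurent_sub Lgam.
  exact: laurent_mon.
have /= h1 := (twisted_vf_x false false y hs' x0).2.
have /= h2 := (twisted_vf_x false false y hs x0).1.
have /= h4 := (twisted_vf_x false false y hs x0).2.
have /= h3 := e10 x y x0 y0.
rewrite ge // expr0z !mul1r in h3.
rewrite hT rmorphD !rmorphM /= h2 h3 mulrDl {1}h4 hP eQ rmorphD !rmorphM /= !eval2C in h1.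
have E1 : x ^ (dd - d1) = x ^ dd / x ^ d1 by rewrite expfzDr // invr_expz.
have E2 : x ^ (- 2%:Z - d1) = (x ^ 2%:Z * x ^ d1)^-1.
  by rewrite -expfzDr // invr_expz; congr (_ ^ _); lia.
have E3 : x ^ (d1 - dd) = x ^ d1 / x ^ dd by rewrite expfzDr // invr_expz.
have E4 : x ^ (dd - 1 - d1) = x ^ dd / (x * x ^ d1).
  have -> : x * x ^ d1 = x ^ (1 + d1) by rewrite expfzDr // expr1z.
  by rewrite invr_expz -expfzDr //; congr (_ ^ _); lia.
have E5 : x ^ (- 2%:Z - dd) = (x ^ 2%:Z * x ^ dd)^-1.
  by rewrite -expfzDr // invr_expz; congr (_ ^ _); lia.
rewrite E1 E2 E4 in h1; rewrite /t10 E3 E5 exprN1 expr1z.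
have Z0 : x ^ 2%:Z != 0 by rewrite expfz_neq0.
have Y0 : x ^ d1 != 0 by rewrite expfz_neq0.
have X0 : x ^ dd != 0 by rewrite expfz_neq0.
have dR : dd%:~R = delta%:R :> K by [].
rewrite dR in h1.
move: (eval2 x^-1 (x ^ dd * y) (m _)) h1 => M.
move: (eval2 x^-1 (x ^ dd * y) _) => Q.
move: (x ^ 2%:Z) (x ^ d1) (x ^ dd) Z0 Y0 X0 => Z Y X Z0 Y0 X0 h1.
apply: (mulfI (x := X / Y)); first by rewrite mulf_neq0 ?invr_eq0.
apply: (addIr (e * (X / Y * eval2 x y (vfy s c00) +
  delta%:R * (X / (x * Y)) * y * eval2 x y (vfx s c00)))).
transitivity (X / Y * (eval2 x y gam * eval2 x y (vfx s c00) +
    e * eval2 x y (vfy s c00)) +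
  delta%:R * (X / (x * Y)) * y * (a * eval2 x y (vfx s c00))); first by field; rewrite x0 Y0.
by rewrite -h1; field; rewrite ?x0 ?X0 ?Y0 ?Z0.
Qed.
End Comparison.

(** * Endomorphisms of the tangent bundle *)

Section TangentEndomorphisms.
Variables (K : numClosedFieldType) (delta : nat).
Local Notation dd := (delta%:Z).
Local Notation c00 := (false, false).

Lemma eval2_homog (n : nat) (C : {mpoly K[2]}) (t u v : K) :
  C \is n.-homog -> eval2 (t * u) (t * v) C = t ^+ n * eval2 u v C.
Proof.
move=> /dhomogP hC; rewrite /eval2 !mevalE mulr_sumr big_seq [RHS]big_seq.
apply: eq_bigr => m /hC mn; have {}mn : mdeg m = n by [].
rewrite -mn mdegE !big_ord_recl !big_ord0.
by rewrite !(tnth_nth 0) /= !mulr1 addn0 !exprMn exprD; ring.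
Qed.

Definition line_coord (i : bool) (C : {mpoly K[2]}) : {mpoly K[2]} :=
  C \mPo [tuple (if i then coord_x K else 1); (if i then 1 else coord_x K)].

Lemma eval2_line_coord i x y C :
  eval2 x y (line_coord i C) = eval2 (if i then x else 1) (if i then 1 else x) C.
Proof.
rewrite /line_coord /eval2 comp_mpoly_meval; apply: meval_eq => k.
case: (ord2P k) => ->; rewrite !(tnth_nth 0) /=; case: i;
  by rewrite ?mevalXU ?meval1 ?(tnth_nth 0).
Qed.

(* The off-diagonal entry, on each chart, of the endomorphism with values in
   the vertical tangent sheaf given by the section C(X_0, X_1) Y_1^2. *)
Definition vert_entry (C : {mpoly K[2]}) (c : chart) : {mpoly K[2]} :=
  (-1) ^+ (c.1 + c.2) * ((if c.2 then 1 else coord_y K ^+ 2) * line_coord c.1 C).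

Definition endo_form (a e : K) (C : {mpoly K[2]}) (c : chart) :
    'M[{mpoly K[2]}]_2 :=
  \matrix_(r, k) (if r == ord0 then (if k == ord0 then a%:MP else 0)
                  else (if k == ord0 then vert_entry C c else e%:MP)).

Lemma eval2_vert_entry C c x y : eval2 x y (vert_entry C c) =
  (-1) ^+ (c.1 + c.2) * ((if c.2 then 1 else y ^+ 2) *
     eval2 (if c.1 then x else 1) (if c.1 then 1 else x) C).
Proof.
rewrite /vert_entry !rmorphM rmorphXn rmorphN rmorph1 /= eval2_line_coord.
by case: c.2; rewrite ?rmorph1 // rmorphXn /= eval2X.
Qed.

Lemma map_endo_form (a e : K) C c (x y : K) :
  map_mx (eval2 x y) (endo_form a e C c) =
  mx2 a 0 (eval2 x y (vert_entry C c)) e.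
Proof. by apply: mx2P; rewrite !mxE /= ?eval2C ?rmorph0. Qed.

Lemma vert_entry0 c : vert_entry 0 c = 0.
Proof. by rewrite /vert_entry /line_coord comp_mpoly0 !mulr0. Qed.

(* Without the second condition the truncated degree (delta - 2)%N would allow
   constants when delta < 2. *)
Definition admissible (C : {mpoly K[2]}) : Prop :=
  C \is (delta - 2)%N.-homog /\ ((delta < 2)%N -> C = 0).

Lemma vert_entry_x C i j x y : admissible C -> x != 0 ->
  x ^ twist delta j * eval2 x y (vert_entry C (i, j)) =
  - x ^ (- 2%:Z) * eval2 x^-1 (x ^ twist delta j * y) (vert_entry C (~~ i, j)).
Proof.
move=> [hC C0] x0; have [lt2|ge2] := ltnP delta 2.
  by rewrite (C0 lt2) !vert_entry0 /eval2 !meval0 !mulr0.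
rewrite !eval2_vert_entry /=.
have -> : eval2 (if ~~ i then x^-1 else 1) (if ~~ i then 1 else x^-1) C =
    x ^- (delta - 2) * eval2 (if i then x else 1) (if i then 1 else x) C.
  have := eval2_homog x^-1 (if i then x else 1) (if i then 1 else x) hC.
  by rewrite exprVn; case: i => /= <-; rewrite ?mulVf ?mulr1.
have -> : (-1) ^+ (~~ i + j) = - (-1) ^+ (i + j) :> K.
  by case: i; case: j; rewrite /= ?addn0 ?expr0 ?expr1 ?sqrrN ?expr1n ?opprK.
have Ex : x ^- (delta - 2) = x ^ 2%:Z / x ^ dd.
  by rewrite exprnN invr_expz -expfzDr //; congr (_ ^ _); lia.
rewrite Ex -invr_expz /twist.
have Z0 : x ^ 2%:Z != 0 by rewrite expfz_neq0.
have X0 : x ^ dd != 0 by rewrite expfz_neq0.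
case: j; rewrite ?exprMn -?[(x ^ - dd)]invr_expz;
  move: (x ^ 2%:Z) (x ^ dd) Z0 X0 => Z X Z0 X0; field; by rewrite X0 Z0.
Qed.

(** The off-diagonal entry of [jacX] is proportional to delta and sees [a] on one side and [e] on
    the other; the rest is the transition rule of O(- 2 - delta, 2). *)
Lemma endo_form_tangent (a e : K) C : delta%:R * (a - e) = 0 -> admissible C ->
  is_tangent_endo delta (endo_form a e C).
Proof.
move=> ae hC; split=> i j x y z0; rewrite !map_endo_form mx2M.
  rewrite mx2M; congr mx2; [by ring|by ring| |by ring].
  rewrite vert_entry_x // [LHS]addrC; congr (_ + _); first by ring.
  have tae : (twist delta j)%:~R * a = (twist delta j)%:~R * e :> K.
    apply/eqP; rewrite -subr_eq0 -mulrBr.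
    by case: j => /=; rewrite ?mulrNz ?mulNr ae ?oppr0.
  transitivity ((twist delta j)%:~R * a * (x ^ (twist delta j - 1) * y)); first by ring.
  by rewrite tae; ring.
rewrite mx2M; congr mx2; [by ring|by ring| |by ring].
rewrite mul0r add0r mulr1 mulr0 addr0 !eval2_vert_entry /=.
have -> : (-1) ^+ (i + ~~ j) = - (-1) ^+ (i + j) :> K.
  by case: i; case: j; rewrite /= ?addn0 ?expr0 ?expr1 ?sqrrN ?expr1n ?opprK.
have Y0 : y ^ 2%:Z != 0 by rewrite expfz_neq0.
rewrite -invr_expz; case: j => /=; rewrite -[y ^ 2%:Z]/(y ^+ 2) in Y0 *; by field.
Qed.

Lemma eval2_vert_entryZ (k : K) C c (x y : K) :
  eval2 x y (vert_entry (k *: C) c) = k * eval2 x y (vert_entry C c).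
Proof.
have eZ u v : eval2 u v (k *: C) = k * eval2 u v C by exact: mevalZ.
by rewrite (eval2_vert_entry C) eval2_vert_entry eZ; ring.
Qed.

Lemma mx2_1 : mx2 1 0 0 1 = 1%:M :> 'M[K]_2.
Proof. by apply: mx2P; rewrite !mxE. Qed.

Lemma endo_form_inv (a e : K) C C' c : a != 0 -> e != 0 ->
  (forall x y, eval2 x y (vert_entry C' c) =
     - (a * e)^-1 * eval2 x y (vert_entry C c)) ->
  endo_form a e C c *m endo_form a^-1 e^-1 C' c = 1%:M /\
  endo_form a^-1 e^-1 C' c *m endo_form a e C c = 1%:M.
Proof.
move=> a0 e0 hC'; pose g x y := eval2 x y (vert_entry C c).
have E x y : map_mx (eval2 x y) (endo_form a e C c) = mx2 a 0 (g x y) e.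
  exact: map_endo_form.
have E' x y : map_mx (eval2 x y) (endo_form a^-1 e^-1 C' c) =
    mx2 a^-1 0 (- (a * e)^-1 * g x y) e^-1 by rewrite map_endo_form hC'.
split; apply: eval2_mx_inj => x y x0 y0; rewrite map_mxM map_mx1 -mx2_1.
  transitivity (mx2 a 0 (g x y) e *m mx2 a^-1 0 (- (a * e)^-1 * g x y) e^-1).
    by congr (_ *m _); [exact: E|exact: E'].
  by rewrite mx2M; congr mx2; field; rewrite ?a0 ?e0.
transitivity (mx2 a^-1 0 (- (a * e)^-1 * g x y) e^-1 *m mx2 a 0 (g x y) e).
  by congr (_ *m _); [exact: E'|exact: E].
by rewrite mx2M; congr mx2; field; rewrite ?a0 ?e0.
Qed.

Lemma admissibleZ (k : K) C : admissible C -> admissible (k *: C).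
Proof.
by move=> [hC C0]; split=> [|/C0 ->]; [exact: dhomogZ|rewrite scaler0].
Qed.

Lemma endo_form_invertible (a e : K) C : a != 0 -> e != 0 ->
  delta%:R * (a - e) = 0 -> admissible C ->
  is_invertible_tangent_endo delta (endo_form a e C).
Proof.
move=> a0 e0 ae hC; split; first exact: endo_form_tangent.
exists (endo_form a^-1 e^-1 (- (a * e)^-1 *: C)); split.
  apply: endo_form_tangent (admissibleZ _ hC).
  have -> : a^-1 - e^-1 = - (a * e)^-1 * (a - e) by field; rewrite a0 e0.
  by rewrite mulrCA ae mulr0.
by move=> c; apply: endo_form_inv => // x y; apply: eval2_vert_entryZ.
Qed.

(** The monomial y / x fits neither p >= 0, which holds for [gam], nor p <= -2, the bound on the sum
    at q = 1; so [kap = 0]. Then p >= 0, q <= 2 and p + 2 <= delta (q - 1) force q = 2 and p <=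
    delta - 2. *)
Lemma vert_entry_form (kap : K) (gam : {mpoly K[2]}) :
  laurent (fun p q => q <= 2) (fun x y => eval2 x y gam) ->
  laurent (fun p q => p <= dd * q - 2 - dd)
    (fun x y => eval2 x y gam + kap * x ^ (-1) * y ^ 1) ->
  kap = 0 /\ exists2 C, admissible C & gam = vert_entry C c00.
Proof.
move=> L2 Lk; have L0 := laurent_eval2 gam.
have k0 : kap = 0.
  have La : laurent (fun p q => (p == -1) && (q == 1)) (fun x y => kap * x ^ (-1) * y ^ 1).
    exact: laurent_mon.
  have Lb : laurent (fun p q => (0 <= p) || (p <= dd * q - 2 - dd))
      (fun x y => kap * x ^ (-1) * y ^ 1).
    apply: (laurent_ext (f := fun x y =>
      (eval2 x y gam + kap * x ^ (-1) * y ^ 1) - eval2 x y gam)).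
      by move=> x y _ _; rewrite addrAC subrr add0r.
    by apply: laurentB; [apply: laurent_sub Lk|apply: laurent_sub L0];
      rewrite /nonneg_supp; lia.
  have := laurent_empty _ (laurentI La Lb) (oner_neq0 K) (oner_neq0 K).
  by rewrite !exp1rz !mulr1; apply; lia.
split=> //; rewrite k0 in Lk.
have L : laurent (fun p q => [&& 2 <= dd, 0 <= p, p <= dd - 2 & q == 2])
    (fun x y => eval2 x y gam).
  have {}Lk : laurent (fun p q => p <= dd * q - 2 - dd) (fun x y => eval2 x y gam).
    by apply: laurent_ext Lk => x y _ _; rewrite !mul0r addr0.
  by apply: laurent_sub (laurentI L0 (laurentI L2 Lk)); rewrite /nonneg_supp; nia.
case: (ltnP delta 2) => [lt2|ge2].
  exists 0; first by split=> //; exact: dhomog0.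
  apply: eval2_torus_inj => x y x0 y0; rewrite vert_entry0 [RHS]meval0.
  by apply: (laurent_empty _ L) => // p q; lia.
have [l /allP lA lE] := L.
pose n := (delta - 2)%N.
(* [C] homogenises the coefficient of y^2: x^p becomes X_0^(delta - 2 - p) X_1^p. *)
exists (\sum_(t <- l) t.1 *: ('X_ord0 ^+ (n - absz t.2.1)%N * 'X_ord_max ^+ absz t.2.1)).
  split; last by rewrite ltnNge ge2.
  rewrite big_seq; apply: rpred_sum => t /lA /and4P[_ t1 t2 _].
  apply: dhomogZ; rewrite [X in X.-homog](_ : _ = 1 * (n - absz t.2.1) + 1 * absz t.2.1)%N.
    by apply: dhomogM; apply: dhomogMn; rewrite dhomogX; apply/eqP; exact: mdeg1.
  rewrite /n; move: t1 t2; rewrite -[t.2.1]/(t.2.1 : int); set p : int := t.2.1; lia.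
apply: eval2_torus_inj => x y x0 y0; rewrite lE // eval2_vert_entry /= expr0 mul1r.
rewrite rmorph_sum /= mulr_sumr big_seq [RHS]big_seq.
apply: eq_bigr => t /lA /and4P[_ t1 t2 /eqP ->].
rewrite -mul_mpolyC !rmorphM !rmorphXn /= eval2C !eval2X /= expr1n mul1r.
by rewrite [x ^+ _]exprnP gez0_abs // mulrC mulrA [_ * t.1]mulrC; ring.
Qed.

(** The upper right entry is a section of O(2 + delta, -2), hence zero. The diagonal entries are
    then global functions, so constants, and [vert_entry_form] handles the remaining one. *)
Lemma tangent_endo_form Phi : is_tangent_endo delta Phi ->
  exists a e C, [/\ delta%:R * (a - e) = 0, admissible C &
    forall c, Phi c = endo_form a e C c].
Proof.
move=> hPhi; have [hx hy] := hPhi.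
pose E r k (c : chart) : {mpoly K[2]} := Phi c r k.
have mapE c x y : map_mx (eval2 x y) (Phi c) =
    mx2 (eval2 x y (E ord0 ord0 c)) (eval2 x y (E ord0 ord_max c))
        (eval2 x y (E ord_max ord0 c)) (eval2 x y (E ord_max ord_max c)).
  by apply: mx2P; rewrite !mxE.
have ey x y r k : x != 0 -> y != 0 -> _ := fun x0 y0 =>
  congr1 (fun M : 'M[K]_2 => M r k) (hy false false x y y0).
have ex x y r k : x != 0 -> y != 0 -> _ := fun x0 y0 =>
  congr1 (fun M : 'M[K]_2 => M r k) (hx false false x y x0).
have b0 : E ord0 ord_max c00 = 0.
  apply: eval2_torus_inj => x y x0 y0; rewrite rmorph0.
  have L : laurent (fun p q => q <= -2) (fun x y => eval2 x y (E ord0 ord_max c00)).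
    apply: (laurent_ext (f := fun x y =>
        -1 * y ^ (- 2%:Z) * eval2 x y^-1 (E ord0 ord_max (false, true)))).
      move=> {}x {}y {}x0 {}y0; have := ey x y ord0 ord_max x0 y0.
      rewrite !mapE !mx2M !mxE /= mul0r addr0 mul1r => ->; ring.
    by apply: (laurent_scaley _ _ (laurent_eval2_0y _)); lia.
  apply: (laurent_empty _ (laurentI L (laurent_eval2 _))) => //.
  by rewrite /nonneg_supp => p q; lia.
have b10 x y : x != 0 -> y != 0 ->
    eval2 x^-1 (x ^ dd * y) (E ord0 ord_max (true, false)) = 0.
  move=> x0 y0; have := ex x y ord0 ord_max x0 y0.
  rewrite !mapE !mx2M !mxE /= b0 rmorph0 !mulr0 !mul0r addr0 add0r => /esym/eqP.
  by rewrite mulf_eq0 expfz_eq0 (negPf x0) andbF orbF => /eqP.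
have cst (f f10 f01 : {mpoly K[2]}) :
    teq (fun x y => eval2 x y f) (fun x y => eval2 x^-1 (x ^ dd * y) f10) ->
    teq (fun x y => eval2 x y f) (fun x y => eval2 x y^-1 f01) ->
    exists a, f = a%:MP.
  move=> f1 f2; have [|a fa] := @laurent_const K (fun x y => eval2 x y f).
    apply: laurent_sub (laurentI (laurent_eval2 f) (laurentI
      (laurent_ext f1 (laurent_eval2_x0 _ _)) (laurent_ext f2 (laurent_eval2_0y _)))).
    by rewrite /nonneg_supp => p q; nia.
  by exists a; apply: eval2_torus_inj => x y x0 y0; rewrite eval2C fa.
have xn0 (x : K) n : x != 0 -> x ^ n != 0 by move=> x0; rewrite expfz_neq0.
have [|| a Ea] := cst (E ord0 ord0 c00) (E ord0 ord0 (true, false))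
    (E ord0 ord0 (false, true)).
- move=> x y x0 y0; have := ex x y ord0 ord0 x0 y0.
  rewrite !mapE !mx2M !mxE /= b10 // !mul0r !addr0 [RHS]mulrC.
  by apply: mulfI; rewrite oppr_eq0 xn0.
- move=> x y x0 y0; have := ey x y ord0 ord0 x0 y0.
  by rewrite !mapE !mx2M !mxE /= !mul0r !mulr0 !addr0 mul1r mulr1.
have [|| e Ee] := cst (E ord_max ord_max c00) (E ord_max ord_max (true, false))
    (E ord_max ord_max (false, true)).
- move=> x y x0 y0; have := ex x y ord_max ord_max x0 y0.
  rewrite !mapE !mx2M !mxE /= b0 rmorph0 !mulr0 !add0r [RHS]mulrC.
  by apply: mulfI; rewrite xn0.
- move=> x y x0 y0; have := ey x y ord_max ord_max x0 y0.
  rewrite !mapE !mx2M !mxE /= !mul0r !mulr0 !add0r [RHS]mulrC.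
  by apply: mulfI; rewrite oppr_eq0 xn0.
have [|| k0 [C hC EC]] := @vert_entry_form (delta%:R * (a - e)) (E ord_max ord0 c00).
- apply: (laurent_ext (f := fun x y =>
      -1 * y ^ 2%:Z * eval2 x y^-1 (E ord_max ord0 (false, true)))).
    move=> x y x0 y0; have := ey x y ord_max ord0 x0 y0.
    rewrite !mapE !mx2M !mxE /= !mul0r !mulr0 !addr0 !add0r mulr1 => <-.
    have := xn0 y 2%:Z y0; rewrite -invr_expz; move: (y ^ 2%:Z) => Z Z0; by field.
  by apply: (laurent_scaley _ _ (laurent_eval2_0y _)); lia.
- apply: (laurent_ext (f := fun x y => -1 * x ^ (- 2%:Z - dd) *
      eval2 x^-1 (x ^ dd * y) (E ord_max ord0 (true, false)))).
    move=> x y x0 y0; have := ex x y ord_max ord0 x0 y0.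
    have Ee10 : eval2 x^-1 (x ^ dd * y) (E ord_max ord_max (true, false)) = e.
      have := ex x y ord_max ord_max x0 y0.
      rewrite !mapE !mx2M !mxE /= b0 Ee eval2C rmorph0 !mulr0 !add0r [RHS]mulrC.
      by move/(mulfI (xn0 x dd x0)) => <-.
    rewrite !mapE !mx2M !mxE /= Ee10 Ea eval2C => h.
    have E1 : x ^ (dd - 1) = x ^ dd / x by rewrite expfzDr // exprN1.
    have E2 : x ^ (- 2%:Z - dd) = (x ^ 2%:Z * x ^ dd)^-1.
      by rewrite -expfzDr // invr_expz; congr (_ ^ _); lia.
    rewrite E1 -invr_expz in h; rewrite E2 exprN1 expr1z.
    have Z0 := xn0 x 2%:Z x0; have X0 := xn0 x dd x0.
    move: (eval2 _ _ _) (eval2 _ _ _) h => u v.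
    move: (x ^ 2%:Z) (x ^ dd) Z0 X0 => Z X Z0 X0 h.
    have dR : dd%:~R = delta%:R :> K by [].
    rewrite dR in h.
    apply: (mulfI X0); apply: (addIr (e * (delta%:R * (X / x) * y))).
    transitivity (delta%:R * (X / x) * y * a + X * v); first by field.
    by rewrite h; field; rewrite ?x0 ?X0 ?Z0.
  by apply: (laurent_scalex _ _ (laurent_eval2_x0 _ _)); lia.
exists a, e, C; split=> //; apply: (tangent_endo_eq hPhi).
  exact: endo_form_tangent.
apply/matrixP => r k; rewrite mxE.
by case: (ord2P r) => ->; case: (ord2P k) => -> /=.
Qed.
End TangentEndomorphisms.

(** * Sections with the same isolated singularities *)

Lemma delta_scalar_eq (K : numClosedFieldType) (delta : nat) (a e : K) :
  (0 < delta)%N -> delta%:R * (a - e) = 0 -> e = a.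
Proof.
move=> dpos /eqP; rewrite mulf_eq0 pnatr_eq0 gtn_eqF //= subr_eq0.
by move/eqP.
Qed.

Section MainArgument.
Variables (K : numClosedFieldType) (delta : nat) (d1 d2 : int).
Variable s : chart -> 'cV[{mpoly K[2]}]_2.
Hypothesis hs : is_twisted_vf delta d1 d2 s.
Hypothesis iso : isolated_singularities s.
Local Notation c00 := (false, false).

Lemma isolated_regular c : regular_pair (vfx s c) (vfy s c).
Proof.
apply: (no_chain_regular_pair (I := sing_ideal s c)) (iso.2 c) => f [u [v ->]].
by exists u, v.
Qed.

(** A chain of length 0 provides a prime, hence proper, ideal above the singular ideal. *)
Lemma isolated_nonempty : exists c, ~ sing_ideal s c 1.
Proof.
have [[c [p [hp _]]] _] := iso; exists c => h1.
have [[[_ p1 _] _] sub] := hp 0%N isT.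
by rewrite (sub _ h1) in p1.
Qed.

(** If one component were a multiple of the other, regularity of the pair would make the latter a
    unit. *)
Lemma regular_nonunit c t : ~ sing_ideal s c 1 ->
  vfx s c <> t * vfy s c /\ vfy s c <> t * vfx s c.
Proof.
move=> h1; split=> e; apply: h1.
  have [|u eu _] := isolated_regular (c := c) (u := 1) (v := t); first by rewrite mul1r.
  by exists 0, u; rewrite mul0r add0r.
have [|u _ eu] := isolated_regular (c := c) (u := t) (v := 1); first by rewrite mul1r.
by exists u, 0; rewrite mul0r addr0.
Qed.

Lemma isolated_vfx_neq0 : vfx s c00 != 0.
Proof.
apply/eqP => P0; have [c h1] := isolated_nonempty.
have Pc : forall c, vfx s c = 0.
  apply: chart_ind => // i j e.
    apply: (@eval2_x_inj _ delta i j (vfx s) (fun=> 0)) => x y x0.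
    by rewrite (twisted_vf_x i j y hs x0).1 e !rmorph0 mulr0.
  apply: (@eval2_y_inj _ i j (vfx s) (fun=> 0)) => x y y0.
  by rewrite (twisted_vf_y i j x hs y0).1 e !rmorph0 mulr0.
by have [+ _] := regular_nonunit 0 h1; apply; rewrite Pc mul0r.
Qed.

Hypothesis hd2 : 1 <= d2.
Hypothesis hd1 : 1 <= d1 \/ (delta = 1%N /\ d1 = 0).

Lemma vfx_endo_form a e C s' c : s' c = endo_form a e C c *m s c ->
  vfx s' c = a%:MP * vfx s c /\
  vfy s' c = vert_entry C c * vfx s c + e%:MP * vfy s c.
Proof.
move=> e'; rewrite /vfx /vfy e' !mxE !big_ord_recl !big_ord0 !mxE /=.
have -> : lift ord0 ord0 = ord_max :> 'I_2 by apply: val_inj.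
by rewrite mul0r !addr0.
Qed.

Lemma same_sing_scheme_endo s' :
  is_twisted_vf delta d1 d2 s' -> same_sing_scheme s s' ->
  exists a e C, [/\ a != 0 /\ e != 0, delta%:R * (a - e) = 0, admissible delta C &
    forall c, s' c = endo_form a e C c *m s c].
Proof.
move=> hs' same.
have in1 c : exists m n, vfx s' c = m * vfx s c + n * vfy s c.
  apply: (proj2 (same c (vfx s' c))); exists 1, 0.
  by rewrite mul1r mul0r addr0.
have in2 c : exists m n, vfy s' c = m * vfx s c + n * vfy s c.
  apply: (proj2 (same c (vfy s' c))); exists 0, 1.
  by rewrite mul1r mul0r add0r.
have P0 := isolated_vfx_neq0; have reg := isolated_regular.
have [a ea] := vfx_proportional hs reg P0 hd2 hd1 hs' in1.
have [e [gam [eq2 L1 L2]]] := vfy_combination hs reg P0 hd2 hd1 hs' ea in2.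
have [ae [C hC eC]] := vert_entry_form L1 L2.
have e' : forall c, s' c = endo_form a e C c *m s c.
  apply: (twisted_vf_eq hs' (endo_act_twisted_vf (endo_form_tangent ae hC) hs)).
  apply/matrixP => r k; rewrite (ord1 k) !mxE !big_ord_recl !big_ord0 !mxE /=.
  have -> : lift ord0 ord0 = ord_max :> 'I_2 by apply: val_inj.
  case: (ord2P r) => -> /=; rewrite ?mul0r !addr0; first exact: ea.
  by rewrite -eC; exact: eq2.
exists a, e, C; split=> //.
have [c h1] := isolated_nonempty.
have [ex ey] := vfx_endo_form (e' c).
have inc f : sing_ideal s c f -> exists m n, f = m * vfx s' c + n * vfy s' c.
  exact: proj1 (same c f).
have [|m [n Pe]] := inc (vfx s c); first by exists 1, 0; rewrite mul1r mul0r addr0.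
have [|m' [n' Qe]] := inc (vfy s c); first by exists 0, 1; rewrite mul1r mul0r add0r.
have nP t := proj1 (regular_nonunit t h1); have nQ t := proj2 (regular_nonunit t h1).
(* If delta = 0, then [C = 0] and the matrix is diagonal; otherwise a = e. In either case a zero on
   the diagonal would make one component of [s] a multiple of the other at a chart with singular
   points. *)
have [d0|dpos] := posnP delta.
  have v0 : vert_entry C c = 0 by rewrite hC.2 ?vert_entry0 ?d0.
  rewrite v0 mul0r add0r in ey; split; apply/eqP => z0.
    by apply: (nP (n * e%:MP)); rewrite {1}Pe ex ey z0 mpolyC0 !mul0r mulr0 add0r mulrA.
  by apply: (nQ (m' * a%:MP)); rewrite {1}Qe ex ey z0 mpolyC0 !mul0r mulr0 addr0 mulrA.
have ea' : a = e.
  by rewrite (delta_scalar_eq dpos ae).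
suff a0 : a != 0 by rewrite -ea'.
apply/eqP => a0; apply: (nQ (n' * vert_entry C c)).
by rewrite {1}Qe ex ey -ea' a0 mpolyC0 !mul0r mulr0 add0r addr0 mulrA.
Qed.

Lemma same_sing_scheme_invertible_endo s' :
  is_twisted_vf delta d1 d2 s' -> same_sing_scheme s s' ->
  exists Phi, is_invertible_tangent_endo delta Phi /\
    forall c, s' c = endo_act Phi s c.
Proof.
move=> hs' same.
have [a [e [C [[a0 e0] ae hC e']]]] := same_sing_scheme_endo hs' same.
by exists (endo_form a e C); split=> //; apply: endo_form_invertible.
Qed.

Lemma same_sing_scheme_foliation s' : delta = 1%N ->
  is_twisted_vf delta d1 d2 s' -> same_sing_scheme s s' -> same_foliation s s'.
Proof.
move=> dE hs' same.
have [a [e [C [[a0 _] ae hC e']]]] := same_sing_scheme_endo hs' same.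
exists a => // c; have C0 : C = 0 by apply: hC.2; rewrite dE.
have {}ae : e = a by apply: delta_scalar_eq ae; rewrite dE.
have [e1 e2] := vfx_endo_form (e' c).
apply: (vfP (s := s') (s' := fun c => a%:MP *: s c)).
  by rewrite e1 [RHS]mxE.
by rewrite e2 C0 ae vert_entry0 mul0r add0r [RHS]mxE.
Qed.
End MainArgument.

(** * Affine forms *)

Section AffineForms.
Variables (K : numClosedFieldType) (delta : nat) (d1 d2 : int).

Lemma bihomogD a b (p q : {mpoly K[4]}) :
  bihomog delta a b p -> bihomog delta a b q -> bihomog delta a b (p + q).
Proof.
by move=> hp hq m /msuppD_le; rewrite mem_cat => /orP[/hp|/hq].
Qed.

Lemma bihomogM a b a' b' (p q : {mpoly K[4]}) :
  bihomog delta a b p -> bihomog delta a' b' q ->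
  bihomog delta (a + a') (b + b') (p * q).
Proof.
move=> hp hq m /msuppM_le /allpairsP[[u v] /= [/hp[u1 u2] /hq[v1 v2] ->]].
by rewrite !mnmDE !PoszD -u1 -u2 -v1 -v2; split; ring.
Qed.

Lemma bihomogC (k : K) : bihomog delta 0 0 k%:MP.
Proof.
move=> m; rewrite msuppC; case: ifP => // _; rewrite inE => /eqP ->.
by rewrite !mnm0E; split; lia.
Qed.

Lemma bihomog_monomial (m : 'X_{1..4}) :
  bihomog delta ((m (iX false))%:Z + (m (iX true))%:Z - delta%:Z * (m (iY true))%:Z)
    ((m (iY false))%:Z + (m (iY true))%:Z) ('X_[m] : {mpoly K[4]}).
Proof. by move=> m'; rewrite msuppX inE => /eqP ->. Qed.

Lemma bihomogX i : bihomog delta 1 0 ('X_(iX i) : {mpoly K[4]}).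
Proof.
have := @bihomog_monomial U_(iX i); rewrite !mnm1E; case: i => /=;
  by rewrite ?mulr0 ?subr0 ?addr0 ?add0r.
Qed.

Lemma bihomogY1 : bihomog delta (- delta%:Z) 1 (Y1 K).
Proof.
by have := @bihomog_monomial U_(iY true); rewrite !mnm1E /= mulr1 !add0r.
Qed.

Definition base_poly (C : {mpoly K[2]}) : {mpoly K[4]} := C \mPo [tuple X0 K; X1 K].

Lemma bihomogXn i (k : nat) : bihomog delta k 0 (('X_(iX i) : {mpoly K[4]}) ^+ k).
Proof.
elim: k => [|k IH]; first by rewrite expr0 -mpolyC1; exact: bihomogC.
by have := bihomogM (@bihomogX i) IH; rewrite -exprS -intS addr0.
Qed.

Lemma bihomogZ a b k (p : {mpoly K[4]}) :
  bihomog delta a b p -> bihomog delta a b (k%:MP * p).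
Proof. by move=> /(bihomogM (@bihomogC k)); rewrite !add0r. Qed.

Lemma bihomog_base (n : nat) C : C \is n.-homog -> bihomog delta n 0 (base_poly C).
Proof.
move=> /dhomogP hC; rewrite /base_poly comp_mpolyEX big_seq.
apply: (big_ind (bihomog delta n 0)) => [m|p q|m /hC mn].
- by rewrite msupp0.
- exact: bihomogD.
have {}mn : mdeg m = n by [].
rewrite -mul_mpolyC; apply: bihomogZ; rewrite comp_mpolyX !big_ord_recl big_ord0.
rewrite !(tnth_nth 0) /= mulr1 -mn mdegE !big_ord_recl big_ord0 addn0 PoszD.
exact: bihomogM (@bihomogXn false _) (@bihomogXn true _).
Qed.

Lemma mk_formE (A0 A1 B0 B1 : {mpoly K[4]}) :
  let Om := mk_form A0 A1 B0 B1 in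
  [/\ Om ord0 (iX false) = A0, Om ord0 (iX true) = A1,
      Om ord0 (iY false) = B0 & Om ord0 (iY true) = B1].
Proof.
have coef i : mk_form A0 A1 B0 B1 ord0 i =
    A0 * (i == iX false)%:R + A1 * (i == iX true)%:R +
    B0 * (i == iY false)%:R + B1 * (i == iY true)%:R by rewrite !mxE.
by split; rewrite coef !(mulr1, mulr0, addr0, add0r).
Qed.

Lemma comp_base C c : base_poly C \mPo chart_point K c = line_coord c.1 C.
Proof.
pose f : {rmorphism {mpoly K[2]} -> {mpoly K[2]}} :=
  comp_mpoly (chart_point K c) \o comp_mpoly [tuple X0 K; X1 K].
pose g : {rmorphism {mpoly K[2]} -> {mpoly K[2]}} :=
  comp_mpoly [tuple (if c.1 then coord_x K else 1); (if c.1 then 1 else coord_x K)].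
apply: (mpoly_rmorph_eq (f := f) (g := g)) => [k|i] /=.
  by rewrite !comp_mpolyC.
by case: (ord2P i) => ->; rewrite !comp_mpolyXU.
Qed.

(** In [represents] the dX coefficients carry [vfy] and the dY coefficients carry [vfx]. So [e]
    scales the former and [a] the latter, and the off-diagonal entry adds a multiple of [B0] to the
    dX part. *)
Definition endo_affine_form (a e : K) (C : {mpoly K[2]})
    (A0 A1 B0 B1 : {mpoly K[4]}) : 'rV[{mpoly K[4]}]_4 :=
  mk_form (e%:MP * A0 - Y1 K * base_poly C * B0 * X1 K)
          (e%:MP * A1 + Y1 K * base_poly C * B0 * X0 K)
          (a%:MP * B0) (a%:MP * B1).

Lemma represents_endo a e C A0 A1 B0 B1 s s' :
  delta%:R * (a - e) = 0 -> admissible delta C ->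
  represents delta d1 d2 (mk_form A0 A1 B0 B1) s ->
  (forall c, s' c = endo_form a e C c *m s c) ->
  represents delta d1 d2 (endo_affine_form a e C A0 A1 B0 B1) s'.
Proof.
move=> ae hC [[hA hB0 hB1 rX rY] [k k0 hk]] hs'.
have [EA0 EA1 EB0 EB1] := mk_formE A0 A1 B0 B1.
have [FA0 FA1 FB0 FB1] := mk_formE
  (e%:MP * A0 - Y1 K * base_poly C * B0 * X1 K)
  (e%:MP * A1 + Y1 K * base_poly C * B0 * X0 K) (a%:MP * B0) (a%:MP * B1).
rewrite /= -/(endo_affine_form a e C A0 A1 B0 B1) in FA0 FA1 FB0 FB1.
have hA0 := hA false; have hA1 := hA true.
rewrite EA0 in hA0; rewrite EA1 in hA1; rewrite EB0 in hB0; rewrite EB1 in hB1.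
rewrite EA0 EA1 EB1 in rX; rewrite EB0 EB1 in rY.
have hN (p : {mpoly K[4]}) u v : bihomog delta u v p -> bihomog delta u v (- p).
  by move/(@bihomogZ _ _ (-1)); rewrite mpolyCN mulN1r.
(* The bidegrees add up: (- delta, 1) + (delta - 2, 0) + (d1 - delta + 2, d2 + 1) + (1, 0). *)
have hcorr i : bihomog delta (d1 - delta%:Z + 1) (d2 + 2)
    (Y1 K * base_poly C * B0 * 'X_(iX i)).
  have [lt2|ge2] := ltnP delta 2.
    by rewrite hC.2 // /base_poly raddf0 mulr0 !mul0r => m; rewrite msupp0.
  have := bihomogM (bihomogM (bihomogM bihomogY1 (bihomog_base hC.1)) hB0) (@bihomogX i).
  by congr (bihomog delta _ _ _); rewrite -?subzn //; lia.
split.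
  split; rewrite ?FA0 ?FA1 ?FB0 ?FB1.
  - case; rewrite ?FA0 ?FA1; apply: bihomogD; first exact: bihomogZ.
    + exact: (hcorr false).
    + exact: bihomogZ.
    + by apply: hN; exact: (hcorr true).
  - exact: bihomogZ.
  - exact: bihomogZ.
  (* The two parts of the first Euler relation are scaled by [e] and by [a], and delta a = delta e;
     the terms in [C] cancel each other. *)
  - have dae : delta%:R * a%:MP = delta%:R * e%:MP :> {mpoly K[4]}.
      apply/eqP; rewrite -subr_eq0 -mulrBr -mpolyCB -[delta%:R](rmorph_nat (@mpolyC 4 K)).
      by rewrite -mpolyCM ae mpolyC0.
    have scE (p : {mpoly K[4]}) : delta%:R *: p = delta%:R * p.
      by rewrite -mul_mpolyC rmorph_nat.
    rewrite scE in rX; rewrite scE.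
    transitivity (e%:MP * (X0 K * A0 + X1 K * A1) - delta%:R * a%:MP * (Y1 K * B1)).
      by ring.
    rewrite dae -[RHS](mulr0 e%:MP) -rX; ring.
  - by rewrite !(mulrCA _ a%:MP) -mulrDr rY mulr0.
exists k; first exact: k0.
move=> c; have [h1 h2] := hk c; have [e1 e2] := vfx_endo_form (hs' c).
rewrite -/(vfx s c) -/(vfy s c) -/(vfx s' c) -/(vfy s' c) in h1 h2 *.
(* Where Y_0 = 1 the chart sees [B1] only. This relation turns [B0] into - y [B1], and [Y1] supplies
   the second factor y of [vert_entry]. *)
have rYc : (if c.2 then coord_y K else 1) * (B0 \mPo chart_point K c) +
    (if c.2 then 1 else coord_y K) * (B1 \mPo chart_point K c) = 0.
  have := congr1 (comp_mpoly (chart_point K c)) rY.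
  by rewrite rmorph0 rmorphD !rmorphM /= !comp_mpolyXU.
have cX i : 'X_(iX i) \mPo chart_point K c = if c.1 (+) i then coord_x K else 1.
  by rewrite comp_mpolyXU /=; case: i => /=; case: (c.1).
have cY1 : Y1 K \mPo chart_point K c = if c.2 then 1 else coord_y K.
  by rewrite comp_mpolyXU /=; case: (c.2).
pose kap : {mpoly K[2]} := (k * (-1) ^+ (c.1 + c.2))%:MP.
have kapE p : (k * (-1) ^+ (c.1 + c.2)) *: p = kap * p by rewrite -mul_mpolyC.
rewrite !scaleNr !kapE e1 e2 in h1 h2 *; rewrite /vert_entry.
have cC p i : (p%:MP * i : {mpoly K[4]}) \mPo chart_point K c =
    p%:MP * (i \mPo chart_point K c).
  by rewrite rmorphM /= comp_mpolyC.
clear kapE hk; clearbody kap.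
have sum0 p q : 1 * p + coord_y K * q = 0 -> p = - (coord_y K * q).
  by rewrite mul1r => /eqP; rewrite addr_eq0 => /eqP.
case: c kap h1 h2 rYc cX cY1 cC {e1 e2} => -[] [] kap /=.
- rewrite FA0 FB0 EA0 EB0 => h1 h2 _ cX cY1 cC.
  split; last by rewrite cC h2 mulrCA.
  by rewrite rmorphB /= cC !rmorphM /= comp_base cY1 cX /= h1 h2; ring.
- rewrite EA0 EB1 FA0 FB1 => h1 h2 /sum0 rYc cX cY1 cC.
  split; last by rewrite cC h2 mulrCA.
  by rewrite rmorphB /= cC !rmorphM /= comp_base cY1 cX /= h1 rYc h2; ring.
- rewrite EA1 EB0 FA1 FB0 => h1 h2 _ cX cY1 cC.
  split; last by rewrite cC h2 mulrCA.
  by rewrite rmorphD /= cC !rmorphM /= comp_base cY1 cX /= h1 h2; ring.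
- rewrite EA1 EB1 FA1 FB1 => h1 h2 /sum0 rYc cX cY1 cC.
  split; last by rewrite cC h2 mulrCA.
  by rewrite rmorphD /= cC !rmorphM /= comp_base cY1 cX /= h1 rYc h2; ring.
Qed.
Lemma endo_form_diag a e a' e' C C' (c : chart) :
  endo_form a e C c *m endo_form a' e' C' c = 1%:M :> 'M[{mpoly K[2]}]_2 ->
  a != 0 /\ e != 0.
Proof.
move=> h; have := congr1 (map_mx (eval2 1 1)) h.
rewrite map_mxM /= !map_endo_form mx2M => /matrixP h1.
have := h1 ord0 ord0; have := h1 ord_max ord_max.
rewrite !mxE /= rmorph1 mulr0 mul0r addr0 add0r => ee aa; split; apply/eqP => z0.
  by move/eqP: aa; rewrite z0 mul0r eq_sym oner_eq0.
by move/eqP: ee; rewrite z0 mul0r eq_sym oner_eq0.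
Qed.

Lemma represents_invertible_endo A0 A1 B0 B1 s Phi :
  represents delta d1 d2 (mk_form A0 A1 B0 B1) s ->
  is_invertible_tangent_endo delta Phi ->
  exists (a e : K) C,
  [/\ a != 0, e != 0, delta%:R * (a - e) = 0, admissible delta C &
    represents delta d1 d2 (endo_affine_form a e C A0 A1 B0 B1) (endo_act Phi s)].
Proof.
move=> hrep [hPhi [Psi [hPsi hinv]]].
have [a [e [C [ae hC PhiE]]]] := tangent_endo_form hPhi.
have [a' [e' [C' [_ _ PsiE]]]] := tangent_endo_form hPsi.
have [a0 e0] : a != 0 /\ e != 0.
  by have := (hinv (false, false)).1; rewrite PhiE PsiE; apply: endo_form_diag.
exists a, e, C; split=> //.
by apply: (represents_endo ae hC hrep) => c; rewrite /endo_act PhiE.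
Qed.

Lemma endo_affine_form0 (a e : K) A0 A1 B0 B1 :
  endo_affine_form a e 0 A0 A1 B0 B1 =
    e%:MP *: (A0 *: dX _ false + A1 *: dX _ true)
    + a%:MP *: (B0 *: dY _ false + B1 *: dY _ true).
Proof.
rewrite /endo_affine_form /base_poly raddf0 mulr0 !mul0r subr0 addr0 /mk_form.
move: (dX _ false) (dX _ true) (dY _ false) (dY _ true) => u v w z.
by rewrite !scalerDr !scalerA addrA.
Qed.

Lemma endo_affine_form_scalar (a : K) C A0 A1 B0 B1 :
  endo_affine_form a a C A0 A1 B0 B1 =
    a%:MP *: mk_form A0 A1 B0 B1
    - (Y1 _ * base_poly C * B0) *: (X1 _ *: dX _ false - X0 _ *: dX _ true).
Proof.
rewrite /endo_affine_form /mk_form.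
move: (dX _ false) (dX _ true) (dY _ false) (dY _ true) => u v w z.
rewrite scalerBr !scalerDr !scalerA scalerBl scalerDl.
move: (_ *: u) (_ *: u) (_ *: v) (_ *: v) (_ *: w) (_ *: z) => p' p q' q r t.
by rewrite opprB [p - p' + _]addrACA [- p' + q']addrC [_ + r]addrAC [LHS]addrAC.
Qed.
End AffineForms.

Theorem theorem5p2 (R : realType) (delta : nat) (d1 d2 : int)
    (hd2 : 1 <= d2)
    (hd1_0 : delta = 0%N -> 1 <= d1)
    (hd1_1 : delta = 1%N -> 0 <= d1)
    (hd1_2 : (2 <= delta)%N -> 2 <= d1)
    (s : chart -> 'cV[{mpoly R[i][2]}]_2)
    (hs : is_foliation delta d1 d2 s)
    (hiso : isolated_singularities s) :
  [/\ (* (i) *)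
      forall s' : chart -> 'cV[{mpoly R[i][2]}]_2,
        is_twisted_vf delta d1 d2 s' -> same_sing_scheme s s' ->
        exists Phi : chart -> 'M[{mpoly R[i][2]}]_2,
          is_invertible_tangent_endo delta Phi /\
          forall c, s' c = endo_act Phi s c,
      (* (ii) *)
      forall A0 A1 B0 B1 : {mpoly R[i][4]},
        represents delta d1 d2 (mk_form A0 A1 B0 B1) s ->
        forall Phi : chart -> 'M[{mpoly R[i][2]}]_2,
          is_invertible_tangent_endo delta Phi ->
          exists Om' : 'rV[{mpoly R[i][4]}]_4,
            [/\ represents delta d1 d2 Om' (endo_act Phi s),
                delta = 0%N ->
                  exists a d : R[i],
                    [/\ a != 0, d != 0 &
                        Om' = a%:MP *: (A0 *: dX _ false + A1 *: dX _ true)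
                            + d%:MP *: (B0 *: dY _ false + B1 *: dY _ true)],
                delta = 1%N ->
                  exists2 a : R[i], a != 0 &
                    Om' = a%:MP *: mk_form A0 A1 B0 B1 &
                (2 <= delta)%N ->
                  exists (a : R[i]) (C : {mpoly R[i][2]}),
                    [/\ a != 0, C \is (delta - 2)%N.-homog &
                        Om' = a%:MP *: mk_form A0 A1 B0 B1
                            - (Y1 _ * (C \mPo [tuple X0 _; X1 _]) * B0)
                              *: (X1 _ *: dX _ false - X0 _ *: dX _ true)]] &
      (* (iii) *)
      delta = 1%N ->
        forall s' : chart -> 'cV[{mpoly R[i][2]}]_2,
          is_foliation delta d1 d2 s' -> same_sing_scheme s s' ->
          same_foliation s s'].
Proof.
have hd1 : 1 <= d1 \/ (delta = 1%N /\ d1 = 0).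
  case: delta hd1_0 hd1_1 hd1_2 {hs} => [|[|n]] h0 h1 h2.
  - by left; apply: h0.
  - by have := h1 erefl; rewrite le_eqVlt => /orP[/eqP <-|]; [right|left].
  - by left; apply: le_trans (h2 isT).
have [hvf _] := hs.
split.
- exact: same_sing_scheme_invertible_endo.
- move=> A0 A1 B0 B1 hrep Phi hPhi.
  have [a [e [C [a0 e0 ae hC rep]]]] := represents_invertible_endo hrep hPhi.
  exists (endo_affine_form a e C A0 A1 B0 B1); split; first exact: rep.
  + move=> d0; have C0 : C = 0 by apply: hC.2; rewrite d0.
    (* The order is exchanged because the scalar of the dX part is the vertical one, [e]. *)
    by exists e, a; split; [exact: e0|exact: a0|rewrite C0; exact: endo_affine_form0].
  + move=> dE; have C0 : C = 0 by apply: hC.2; rewrite dE.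
    exists a; first exact: a0.
    have -> : e = a by apply: delta_scalar_eq ae; rewrite dE.
    rewrite C0 endo_affine_form_scalar /base_poly raddf0 mulr0 mul0r scale0r.
    exact: subr0.
  + move=> d2'; have -> : e = a by apply: delta_scalar_eq ae; apply: leq_trans d2'.
    exists a, C; split; [exact: a0|exact: hC.1|exact: endo_affine_form_scalar].
- move=> dE s' [hs' _] same.
  exact: (same_sing_scheme_foliation hvf hiso hd2 hd1 dE hs' same).
Qed.
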